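(* Let $\Phi$ be a fan in a finite-dimensional real vector space $V$. Every object $\mathcal{M}$ of $\mathfrak{M}(\mathcal{A}_\Phi)$ is isomorphic to a direct sum of minimal sheaves. In particular, $\mathcal{M}$ is a direct sum of indecomposable objects of the form $\mathcal{L}_\Phi^\sigma(t)$ with $\sigma\in\Phi$, $t\in\mathbb{Z}$.
   Context: Fans. Let $V$ be a real vector space of dimension $n$. A fan $\Phi$ in $V$ is a finite collection of closed convex polyhedral cones with vertex at the origin such that any two cones in $\Phi$ intersect along a common face, and every face of a cone in $\Phi$ is in $\Phi$; the origin $o$ is the unique minimal cone of every fan. Write $\tau\le\sigma$ if $\tau$ is a face of $\sigma$. $\Phi$ is viewed as a topological space whose points are the cones and whose open subsets are the subfans. For a cone $\sigma$, $[\sigma]$ denotes the open set of all faces of $\sigma$, $\partial\sigma$ the subfan of proper faces of $\sigma$, and $\mathrm{Star}(\sigma)=\{\tau\in\Phi:\tau\ge\sigma\}$ (a closed subset). A sheaf $F$ on $\Phi$ is the same as a system of stalks $F_\sigma=\Gamma([\sigma];F)$ with compatible restriction maps $F_\sigma\to F_\tau$ for $\tau\le\sigma$. A sheaf is flabby if sections over any open subset extend to $\Phi$. Structure sheaf. $A=\mathrm{Sym}(V^* )$, graded with $V^*$ in degree 2. $\mathcal{A}_\Phi$ is the sheaf of graded algebras with stalk $\mathcal{A}_{\Phi,\sigma}=\mathrm{Sym}(\mathrm{Span}(\sigma)^* )$ and restriction of functions as structure maps. An $\mathcal{A}_\Phi$-module means a locally finitely generated graded $\mathcal{A}_\Phi$-module;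 it is locally free if each stalk $\mathcal{M}_\sigma$ is a free graded $\mathcal{A}_{\Phi,\sigma}$-module. $\mathfrak{M}(\mathcal{A}_\Phi)$ is the additive category of flabby locally free $\mathcal{A}_\Phi$-modules, with morphisms of degree zero. For a graded $A$-module $M$, $\overline{M}=M/A^+M$ with $A^+\subset A$ the ideal of elements of positive degree; $M(t)_k=M_{k+t}$. Minimal sheaves. An object $\mathcal{M}$ of $\mathfrak{M}(\mathcal{A}_\Phi)$ is a minimal sheaf based at $\sigma\in\Phi$ if (1) $\mathcal{M}_\sigma\neq0$ and $\mathcal{M}_\tau\ne0$ only if $\tau\in\mathrm{Star}(\sigma)$; (2) for every $\tau\in\mathrm{Star}(\sigma)$, $\tau\ne\sigma$, the canonical map $\overline{\mathcal{M}_\tau}\to\overline{\Gamma(\partial\tau;\mathcal{M})}$ is an isomorphism. $\mathcal{L}_\Phi^\sigma$ denotes the (unique up to isomorphism) minimal sheaf based at $\sigma$ with stalk at $\sigma$ isomorphic to $\mathcal{A}_{\Phi,\sigma}$. *)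

(* Defs.v *)
From HB Require Import structures.
From mathcomp Require Import all_boot all_order all_algebra.
From mathcomp Require Import generic_quotient ring_quotient.
From mathcomp Require Import boolp classical_sets reals.
From mathcomp Require Import mpoly.

Set Implicit Arguments.
Unset Strict Implicit.
Unset Printing Implicit Defensive.

Import Order.TTheory GRing.Theory Num.Theory.
Local Open Scope ring_scope.
Local Open Scope classical_set_scope.

Section Fans.
Variables (R : realType) (V : vectType R).

Definition cone_of (s : seq V) : set V :=
  [set v | exists2 c : 'I_(size s) -> R,
             forall i, 0 <= c i & v = \sum_i c i *: s`_i].

Definition face (F C : set V) : Prop :=
  exists2 l : 'Hom(V, R^o),
    forall v, C v -> 0 <= l v & F = C `&` [set v | l v = 0].

(* A closed convex polyhedral cone is presented by a finite list of generators;
   a fan is indexed by a finite type, distinct indices giving distinct cones.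
   [fan_vertex] says that the origin is a vertex of each cone. *)
Record fan := Fan {
  fan_idx :> finType;
  gens : fan_idx -> seq V;
  cone := fun s => cone_of (gens s);
  fan_inj : injective cone;
  fan_vertex : forall s v, cone s v -> cone s (- v) -> v = 0;
  fan_origin : exists o, cone o = [set 0];
  fan_inter : forall s t,
    face (cone s `&` cone t) (cone s) /\ face (cone s `&` cone t) (cone t);
  fan_face : forall s F, face F (cone s) -> exists t, cone t = F }.

Variable Phi : fan.
Implicit Types s t u : Phi.

(* [fle t s] is t <= s: t is a face of s. *)
Definition fle t s : bool := `[< face (cone t) (cone s) >].

(* The linear span of the cone, whatever the generators: see [Span_spec]. *)
Definition Span s : {vspace V} := <<gens s>>%VS.

(* The open subsets of Phi are the subfans. *)
Definition fopen (U : {set Phi}) : Prop :=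
  forall s t, s \in U -> fle t s -> t \in U.

Definition boundary s : {set Phi} := [set t | fle t s && (t != s)]%SET.

Definition Star s : {set Phi} := [set t | fle s t]%SET.

Lemma Span_spec s (W : {vspace V}) :
  (Span s <= W)%VS <-> (forall v, cone s v -> v \in W).
Proof.
split=> [sW v [c _ ->]|cW].
  apply: (subvP sW); apply: memv_suml => i _; apply: memvZ.
  by apply: memv_span; apply: mem_nth.
apply/span_subvP => v vs; apply: cW.
have vi : (index v (gens s) < size (gens s))%N by rewrite index_mem.
exists (fun i => (i == Ordinal vi)%:R); first by move=> i; case: eqP.
rewrite (bigD1 (Ordinal vi)) //= eqxx scale1r nth_index // big1 ?addr0 //.
by move=> i /negPf ->; rewrite scale0r.
Qed.

Lemma fle_Span s t : fle t s -> (Span t <= Span s)%VS.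
Proof.
move=> /asboolP[l _ e]; apply/Span_spec => v; rewrite e => -[vs _].
exact: (proj1 (Span_spec s _) (subvv _)).
Qed.

End Fans.

Section Sym.
Variables (R : realType) (V : vectType R).
Implicit Types W : {vspace V}.

(* Sym(W^* ) is {mpoly R[\dim W]}, the variables being the basis of W^* dual to
   [vbasis W].  For W' included in W, [restr W W'] sends the i-th coordinate
   form of W to its restriction to W', written on the coordinate forms of W';
   see [restr_eval]. *)
Definition restr W W' : {rmorphism {mpoly R[\dim W]} -> {mpoly R[\dim W']}} :=
  comp_mpoly
    [tuple \sum_(j < \dim W') coord (vbasis W) i (vbasis W')`_j *: 'X_j | i < \dim W].

Lemma restrXU W W' i : restr W W' 'X_i =
  \sum_(j < \dim W') coord (vbasis W) i (vbasis W')`_j *: 'X_j.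
Proof. by rewrite [LHS]mmapX mmap1U tnth_mktuple. Qed.

Lemma restr_eval W W' (p : {mpoly R[\dim W]}) v : v \in W' ->
  (restr W W' p).@[fun j => coord (vbasis W') j v]
  = p.@[fun i => coord (vbasis W) i v].
Proof.
move=> vW'; rewrite comp_mpoly_meval; apply: meval_eq => i.
rewrite tnth_mktuple (raddf_sum (meval _)) [in RHS](coord_vbasis vW') linear_sum /=.
by apply: eq_bigr => j _; rewrite mevalZ mevalXU linearZ mulrC.
Qed.

Lemma restr_comp W W' W'' (p : {mpoly R[\dim W]}) : (W'' <= W')%VS ->
  restr W' W'' (restr W W' p) = restr W W'' p.
Proof.
move=> sW; rewrite [restr W W' p]comp_mpolyEX [RHS]comp_mpolyEX raddf_sum /=.
apply: eq_bigr => m _; rewrite comp_mpolyZ !comp_mpolyX rmorph_prod /=.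
congr (_ *: _); apply: eq_bigr => i _; rewrite rmorphXn /=; congr (_ ^+ _).
rewrite !tnth_mktuple raddf_sum /=.
under eq_bigr => j _.
  rewrite comp_mpolyZ restrXU scaler_sumr.
  over.
rewrite exchange_big /=; apply: eq_bigr => k _.
under eq_bigr => j _ do rewrite scalerA.
rewrite -scaler_suml; congr (_ *: _).
have kW' : (vbasis W'')`_k \in W'.
  by apply: (subvP sW); apply: vbasis_mem; apply: mem_nth; rewrite size_tuple.
rewrite [in RHS](coord_vbasis kW') linear_sum /=.
by apply: eq_bigr => j _; rewrite linearZ mulrC.
Qed.

End Sym.

Section GradedModules.
Variables (R : realType) (n : nat).
Local Notation A := {mpoly R[n]}.

(* Graded modules over A, the variables of A having degree 2; [gdeg k x] says
   that x is homogeneous of degree k. *)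
Record gmod := GMod {
  gcar :> lmodType A;
  gdeg : int -> gcar -> Prop;
  gdeg0 : forall k, gdeg k 0;
  gdegB : forall k x y, gdeg k x -> gdeg k y -> gdeg k (x - y);
  gdegZ : forall k d (a : A) x,
    a \is d.-homog -> gdeg k x -> gdeg (k + (2 * d)%N%:Z) (a *: x);
  gdeg_sum : forall x, exists (s : seq int) (f : int -> gcar),
    [/\ uniq s, forall k, gdeg k (f k) & x = \sum_(k <- s) f k];
  gdeg_direct : forall (s : seq int) (f : int -> gcar),
    uniq s -> (forall k, gdeg k (f k)) -> \sum_(k <- s) f k = 0 ->
    forall k, k \in s -> f k = 0 }.

Record ghom (M N : gmod) := GHom {
  gfun :> {linear M -> N};
  ghom_deg : forall k x, gdeg k x -> gdeg k (gfun x) }.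

Definition giso (M N : gmod) : Prop :=
  exists (f : ghom M N) (g : ghom N M), cancel f g /\ cancel g f.

Definition fin_gen (M : lmodType A) : Prop :=
  exists m (e : 'I_m -> M),
    forall x, exists c : {ffun 'I_m -> A}, x = \sum_i c i *: e i.

(* Used for finitely generated modules only, so bases are finite. *)
Definition gfree (M : gmod) : Prop :=
  exists m (e : 'I_m -> M), (forall i, exists k, gdeg k (e i)) /\
    forall x, exists! c : {ffun 'I_m -> A}, x = \sum_i c i *: e i.

Fact gzero_deg_sum (x : 'rV[A]_0) : exists (s : seq int) (f : int -> 'rV[A]_0),
  [/\ uniq s, forall k, (fun _ _ => True) k (f k) & x = \sum_(k <- s) f k].
Proof. by exists [::], (fun=> 0); rewrite big_nil [x]thinmx0. Qed.

Definition gzero : gmod := @GMod 'rV[A]_0 (fun _ _ => True)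
  (fun _ => I) (fun _ _ _ _ _ => I) (fun _ _ _ _ _ _ => I) gzero_deg_sum
  (fun _ f _ _ _ k _ => thinmx0 (f k)).

Section Sum.
Variables M N : gmod.
Let deg k (x : M * N) : Prop := gdeg k x.1 /\ gdeg k x.2.

Fact gadd_deg0 k : deg k 0.
Proof. by split; apply: gdeg0. Qed.

Fact gadd_degB k x y : deg k x -> deg k y -> deg k (x - y).
Proof. by move=> [? ?] [? ?]; split; apply: gdegB. Qed.

Fact gadd_degZ k d (a : A) x :
  a \is d.-homog -> deg k x -> deg (k + (2 * d)%N%:Z) (a *: x).
Proof. by move=> ha [? ?]; split; apply: gdegZ. Qed.

Fact gadd_deg_sum x : exists (s : seq int) (f : int -> (M * N)%type),
  [/\ uniq s, forall k, deg k (f k) & x = \sum_(k <- s) f k].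
Proof.
case: x => x y.
have [s [f [us hf ->]]] := gdeg_sum x; have [t [g [ut hg ->]]] := gdeg_sum y.
exists (undup (s ++ t)).
exists (fun k => (if k \in s then f k else 0, if k \in t then g k else 0)).
split; first exact: undup_uniq.
  by move=> k; split=> /=; case: ifP => // _; apply: gdeg0.
have sub (L : lmodType A) (h : int -> L) r : uniq r ->
    {subset r <= s ++ t} ->
    \sum_(k <- r) h k
    = \sum_(k <- undup (s ++ t)) (if k \in r then h k else 0).
  move=> ur sr; rewrite -big_mkcond -big_filter; apply: perm_big.
  apply: uniq_perm => //; first by rewrite filter_uniq ?undup_uniq.
  by move=> k; rewrite mem_filter mem_undup; case: (boolP (k \in r)) => // /sr.
rewrite (sub _ f s us); last by move=> k ks; rewrite mem_cat ks.
rewrite (sub _ g t ut); last by move=> k kt; rewrite mem_cat kt orbT.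
by elim/big_ind3: _ => // [[a b] _ _ [c d] _ _] /= [-> ->] [-> ->].
Qed.

Fact gadd_deg_direct (s : seq int) (f : int -> (M * N)%type) :
  uniq s -> (forall k, deg k (f k)) -> \sum_(k <- s) f k = 0 ->
  forall k, k \in s -> f k = 0.
Proof.
move=> us hf f0 k ks.
have f1 : \sum_(l <- s) (f l).1 = 0.
  by have := congr1 fst f0; rewrite raddf_sum.
have f2 : \sum_(l <- s) (f l).2 = 0.
  by have := congr1 snd f0; rewrite raddf_sum.
have := gdeg_direct us (fun l => (hf l).1) f1 ks.
have := gdeg_direct us (fun l => (hf l).2) f2 ks.
by case: (f k) => a b /= -> ->.
Qed.

Fact gadd_fg : fin_gen M -> fin_gen N -> fin_gen (M * N)%type.
Proof.
move=> [m [e he]] [l [e' he']]; exists (m + l)%N.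
exists (fun i => match split i with inl j => (e j, 0) | inr j => (0, e' j) end).
move=> [x y]; have [c ->] := he x; have [d ->] := he' y.
exists [ffun i => match split i with inl j => c j | inr j => d j end].
have sl i : split (lshift l i) = inl i :> 'I_m + 'I_l := unsplitK (inl i).
have sr i : split (rshift m i) = inr i :> 'I_m + 'I_l := unsplitK (inr i).
rewrite big_split_ord /=.
transitivity (\sum_(i < m) c i *: ((e i, 0) : M * N)
              + \sum_(i < l) d i *: ((0, e' i) : M * N)); last first.
  by congr (_ + _); apply: eq_bigr => i _; rewrite ffunE ?sl ?sr.
apply/eqP; rewrite -pair_eqE /=; apply/andP; split; apply/eqP.
  rewrite (raddf_sum fst) (raddf_sum fst) /= [X in _ = _ + X]big1 ?addr0 //.
  by move=> i _; rewrite scaler0.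
rewrite (raddf_sum snd) (raddf_sum snd) /= [X in _ = X + _]big1 ?add0r //.
by move=> i _; rewrite scaler0.
Qed.

Definition gadd : gmod := @GMod (M * N)%type deg
  gadd_deg0 gadd_degB gadd_degZ gadd_deg_sum gadd_deg_direct.
End Sum.

Section Shift.
Variables (t : int) (M : gmod).
Let deg k (x : M) : Prop := gdeg (k + t) x.

Fact gshift_degZ k d (a : A) x :
  a \is d.-homog -> deg k x -> deg (k + (2 * d)%N%:Z) (a *: x).
Proof. by move=> ha; rewrite /deg addrAC; apply: gdegZ. Qed.

Fact gshift_deg_sum x : exists (s : seq int) (f : int -> M),
  [/\ uniq s, forall k, deg k (f k) & x = \sum_(k <- s) f k].
Proof.
have [s [f [us hf ->]]] := gdeg_sum x.
exists [seq k - t | k <- s], (fun k => f (k + t)); split=> //.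
- by rewrite map_inj_uniq //; apply: addIr.
- by move=> k; apply: hf.
- by rewrite big_map; apply: eq_bigr => k _; rewrite subrK.
Qed.

Fact gshift_deg_direct (s : seq int) (f : int -> M) :
  uniq s -> (forall k, deg k (f k)) -> \sum_(k <- s) f k = 0 ->
  forall k, k \in s -> f k = 0.
Proof.
move=> us hf f0 k ks.
rewrite -[k](addrK t) -[f _]/((fun l => f (l - t)) (k + t)).
apply: (@gdeg_direct M [seq l + t | l <- s]).
- by rewrite map_inj_uniq //; apply: addIr.
- by move=> l; have := hf (l - t); rewrite /deg subrK.
- by rewrite big_map -[RHS]f0; apply: eq_bigr => l _; rewrite addrK.
- exact: (map_f (fun l => l + t)).
Qed.

Definition gshift : gmod := @GMod M deg
  (fun k => gdeg0 M (k + t)) (fun k => @gdegB M (k + t))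
  gshift_degZ gshift_deg_sum gshift_deg_direct.
End Shift.

Section Regular.
Let deg (k : int) (p : A^o) : Prop :=
  forall m, m \in msupp (p : A) -> k = (2 * mdeg m)%N.

Fact greg_deg0 k : deg k 0.
Proof. by move=> m; rewrite msupp0. Qed.

Fact greg_degB k p q : deg k p -> deg k q -> deg k (p - q).
Proof.
by move=> hp hq m /msuppB_le; rewrite mem_cat => /orP[/hp|/hq].
Qed.

Fact greg_degZ k d (a : A) p :
  a \is d.-homog -> deg k p -> deg (k + (2 * d)%N%:Z) (a *: p).
Proof.
move=> /dhomogP ha hp m /msuppM_le/allpairsP[[m1 m2] /= [/ha <- /hp -> ->]].
by rewrite mdegD mulnDr PoszD addrC.
Qed.

Fact greg_deg_sum p : exists (s : seq int) (f : int -> A^o),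
  [/\ uniq s, forall k, deg k (f k) & p = \sum_(k <- s) f k].
Proof.
exists [seq (2 * d)%N%:Z | d <- iota 0 (msize p)].
exists (fun k => if k is Posz m
                 then if odd m then 0 else pihomog mdeg m./2 p else 0).
split.
- rewrite map_inj_uniq ?iota_uniq // => d e [].
  by rewrite !mul2n => /double_inj.
- case=> m; last exact: greg_deg0.
  case: ifP => om; first exact: greg_deg0.
  move=> l /(dhomog_mf (pihomogP mdeg m./2 p)) /= ->.
  by rewrite mul2n halfK om subn0.
- rewrite big_map -[X in iota _ X]subn0 -[iota _ _]/(index_iota 0 _).
  rewrite big_mkord [LHS](pihomog_partitionE (mf := mdeg) (leqnn _)).
  by apply: eq_bigr => d _; rewrite mul2n odd_double doubleK.
Qed.

Fact greg_deg_direct (s : seq int) (f : int -> A^o) :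
  uniq s -> (forall k, deg k (f k)) -> \sum_(k <- s) f k = 0 ->
  forall k, k \in s -> f k = 0.
Proof.
move=> us hf f0 k ks; apply/mpolyP => m; rewrite mcoeff0.
apply: memN_msupp_eq0; apply/negP => mk.
have := congr1 (mcoeff m) f0; rewrite mcoeff0 raddf_sum /= (bigD1_seq k) //=.
rewrite big1 ?addr0; first by move/eqP; rewrite mcoeff_eq0 mk.
move=> l lk; apply/eqP; rewrite mcoeff_eq0; apply: contra lk => /hf ->.
by rewrite (hf _ _ mk).
Qed.

(* A as a graded module over itself. *)
Definition greg : gmod := @GMod A^o deg
  greg_deg0 greg_degB greg_degZ greg_deg_sum greg_deg_direct.
End Regular.

Section Bar.
Variable N : lmodType A.

(* A^+ N, where A^+ consists of the polynomials without constant term. *)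
Definition plus_sub : {pred N} := fun x =>
  `[< exists m (a : 'I_m -> A) (y : 'I_m -> N),
        (forall i, (a i)@_0%MM = 0) /\ x = \sum_i a i *: y i >].

Fact plus_sub_closed : zmod_closed plus_sub.
Proof.
split=> [|x y /asboolP[m [a [u [ha ->]]]] /asboolP[l [b [v [hb ->]]]]].
  apply/asboolP; exists 0%N, (fun=> 0), (fun=> 0).
  by split=> [[]|]; rewrite ?big_ord0.
apply/asboolP; exists (m + l)%N.
exists (fun i => match split i with inl j => a j | inr j => - b j end).
exists (fun i => match split i with inl j => u j | inr j => v j end).
split=> [i|]; first by case: split => j; rewrite ?mcoeffN ?ha ?hb ?oppr0.
rewrite big_split_ord /= -sumrN; congr (_ + _); apply: eq_bigr => i _.
  by have := unsplitK (inl i : 'I_m + 'I_l); rewrite /= => ->.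
by have := unsplitK (inr i : 'I_m + 'I_l); rewrite /= => ->; rewrite scaleNr.
Qed.

HB.instance Definition _ :=
  GRing.isZmodClosed.Build N plus_sub plus_sub_closed.

Definition bar := @Quotient.quot N plus_sub.
End Bar.

Definition bar_map (M N : lmodType A) (f : {linear M -> N}) (u : bar M) :
  bar N := (\pi_(bar N) (f (repr u)))%qT.

Lemma bar_map_pi (M N : lmodType A) (f : {linear M -> N}) x :
  bar_map f (\pi_(bar M) x)%qT = (\pi_(bar N) (f x))%qT.
Proof.
apply/eqP; rewrite -Quotient.idealrBE -linearB.
have /eqP := reprK (\pi_(bar M) x)%qT; rewrite -Quotient.idealrBE.
move=> /asboolP[m [a [y [ha ->]]]]; apply/asboolP.
exists m, a, (fun i => f (y i)); split=> //.
by rewrite linear_sum; apply: eq_bigr => i _; rewrite linearZ.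
Qed.

End GradedModules.

Section RestrictScalars.
Variables (A B : nzRingType).

(* N as an A-module, through f. *)
Definition rscal (f : {rmorphism A -> B}) (N : lmodType B) : Type := N.

Variables (f : {rmorphism A -> B}) (N : lmodType B).

HB.instance Definition _ := GRing.Zmodule.copy (rscal f N) N.

Let act (a : A) (x : rscal f N) : rscal f N := f a *: (x : N).

Fact rscalA a b x : act a (act b x) = act (a * b) x.
Proof. by rewrite /act scalerA rmorphM. Qed.

Fact rscal1 : left_id 1 act.
Proof. by move=> x; rewrite /act rmorph1 scale1r. Qed.

Fact rscalDr : right_distributive act +%R.
Proof. by move=> a x y; rewrite /act scalerDr. Qed.

Fact rscalDl x : {morph act^~ x : a b / a + b}.
Proof. by move=> a b; rewrite /act rmorphD scalerDl. Qed.

HB.instance Definition _ := GRing.Zmodule_isLmodule.Build A (rscal f N)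
  rscalA rscal1 rscalDr rscalDl.
End RestrictScalars.

Section Sheaves.
Variables (R : realType) (V : vectType R) (Phi : fan V).
Implicit Types s t u : Phi.

(* A = Sym(V^* ) *)
Local Notation A := {mpoly R[\dim {:V}%VS]}.

(* Sheaves of locally finitely generated graded modules over the structure
   sheaf, given by their stalks and restriction maps. *)
Record sheaf := Sheaf {
  stalk :> forall s, gmod R (\dim (Span s));
  res : forall s t, fle t s -> stalk s -> stalk t;
  res_semilinear : forall s t (h : fle t s) a x y,
    res h (a *: x + y) = restr (Span s) (Span t) a *: res h x + res h y;
  res_deg : forall s t (h : fle t s) k x, gdeg k x -> gdeg k (res h x);
  res_id : forall s (h : fle s s) x, res h x = x;
  res_comp : forall s t u (h : fle t s) (h' : fle u t) (h'' : fle u s) x,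
    res h' (res h x) = res h'' x;
  sheaf_fg : forall s, fin_gen (stalk s) }.

Arguments res M {s t} h x : rename.

Section Sections.
Variables (M : sheaf) (U : {set Phi}).

Lemma resD s t (h : fle t s) : {morph res M h : x y / x + y}.
Proof.
by move=> x y; have := res_semilinear h 1 x y; rewrite rmorph1 !scale1r.
Qed.

Lemma res0 s t (h : fle t s) : res M h 0 = 0.
Proof. by apply: (addIr (res M h 0)); rewrite -resD !add0r. Qed.

Lemma resN s t (h : fle t s) : {morph res M h : x / - x}.
Proof. by move=> x; apply: (addrI (res M h x)); rewrite -resD !subrr res0. Qed.

Lemma resZ s t (h : fle t s) a x :
  res M h (a *: x) = restr (Span s) (Span t) a *: res M h x.
Proof. by have := res_semilinear h a x 0; rewrite res0 !addr0. Qed.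

(* Gamma(U; M), for U open *)
Record sect := Sect {
  sect_at : forall s, s \in U -> M s;
  sect_compat : forall s t (sU : s \in U) (tU : t \in U) (h : fle t s),
    res M h (sect_at sU) = sect_at tU }.

HB.instance Definition _ := gen_eqMixin sect.
HB.instance Definition _ := gen_choiceMixin sect.

Lemma sectP (x y : sect) :
  (forall s (sU : s \in U), sect_at x sU = sect_at y sU) -> x = y.
Proof.
case: x y => [x hx] [y hy] /= e.
have exy : x = y by apply: functional_extensionality_dep => s;
  apply: functional_extensionality_dep => sU; apply: e.
by subst y; congr Sect; apply: Prop_irrelevance.
Qed.

Program Definition sect0 : sect := @Sect (fun s _ => 0) _.
Next Obligation. exact: res0. Qed.

Program Definition sectD (x y : sect) : sect :=
  @Sect (fun s sU => sect_at x sU + sect_at y sU) _.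
Next Obligation. by rewrite resD !(sect_compat _ _ tU). Qed.

Program Definition sectN (x : sect) : sect :=
  @Sect (fun s sU => - sect_at x sU) _.
Next Obligation. by rewrite resN (sect_compat _ _ tU). Qed.

Program Definition sectZ (a : A) (x : sect) : sect :=
  @Sect (fun s sU => restr fullv (Span s) a *: sect_at x sU) _.
Next Obligation. by rewrite resZ restr_comp ?fle_Span // (sect_compat _ _ tU). Qed.

Fact sectDA : associative sectD.
Proof. by move=> x y z; apply: sectP => s sU /=; rewrite addrA. Qed.

Fact sectDC : commutative sectD.
Proof. by move=> x y; apply: sectP => s sU /=; rewrite addrC. Qed.

Fact sect0D : left_id sect0 sectD.
Proof. by move=> x; apply: sectP => s sU /=; rewrite add0r. Qed.

Fact sectND : left_inverse sect0 sectN sectD.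
Proof. by move=> x; apply: sectP => s sU /=; rewrite addNr. Qed.

HB.instance Definition _ :=
  GRing.isZmodule.Build sect sectDA sectDC sect0D sectND.

Fact sectZA a b x : sectZ a (sectZ b x) = sectZ (a * b) x.
Proof. by apply: sectP => s sU /=; rewrite scalerA rmorphM. Qed.

Fact sect1Z : left_id 1 sectZ.
Proof. by move=> x; apply: sectP => s sU /=; rewrite rmorph1 scale1r. Qed.

Fact sectZDr : right_distributive sectZ +%R.
Proof. by move=> a x y; apply: sectP => s sU /=; rewrite scalerDr. Qed.

Fact sectZDl x : {morph sectZ^~ x : a b / a + b}.
Proof. by move=> a b; apply: sectP => s sU /=; rewrite rmorphD scalerDl. Qed.

HB.instance Definition _ := GRing.Zmodule_isLmodule.Build A sect
  sectZA sect1Z sectZDr sectZDl.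

End Sections.

Program Definition sect_res (M : sheaf) (U W : {set Phi}) (sUW : U \subset W)
  (x : sect M W) : sect M U :=
  @Sect M U (fun s sU => sect_at x (fintype.subsetP sUW s sU)) _.
Next Obligation. exact: sect_compat. Qed.

Definition flabby (M : sheaf) : Prop :=
  forall U, fopen U -> forall x : sect M U,
    exists y : sect M [set: Phi]%SET, sect_res (finset.subsetT U) y = x.

Definition locally_free (M : sheaf) : Prop := forall s, gfree (M s).

(* The objects of the category of flabby locally free modules. *)
Definition frakM (M : sheaf) : Prop := flabby M /\ locally_free M.

Lemma boundary_fle s t : t \in boundary s -> fle t s.
Proof. by rewrite inE => /andP[]. Qed.

Section ToBoundary.
Variables (M : sheaf) (s : Phi).

Local Notation stalkA := (rscal (restr fullv (Span s)) (M s)).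

Program Definition to_boundary (x : stalkA) : sect M (boundary s) :=
  @Sect M (boundary s) (fun t tU => res M (boundary_fle tU) x) _.
Next Obligation. by rewrite (res_comp _ _ (boundary_fle tU)). Qed.

Fact to_boundary_linear : linear to_boundary.
Proof.
move=> a x y; apply: sectP => t tU /=.
rewrite res_semilinear restr_comp //.
by rewrite fle_Span // boundary_fle.
Qed.

HB.instance Definition _ := GRing.isLinear.Build A stalkA
  (sect M (boundary s)) _ to_boundary to_boundary_linear.
End ToBoundary.

Definition nonzero_at (M : sheaf) s : Prop := exists x : M s, x != 0.

(* The last clause: a bijective induced map is an isomorphism, [to_boundary]
   being linear over A and of degree zero. *)
Definition minimal_sheaf s (M : sheaf) : Prop :=
  [/\ frakM M,
      nonzero_at M s,
      forall t, nonzero_at M t -> t \in Star s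
    & forall t, t \in Star s -> t != s ->
        bijective (bar_map (@to_boundary M t))].

(* M is (isomorphic to) the minimal sheaf L^s. *)
Definition is_L s (M : sheaf) : Prop :=
  minimal_sheaf s M /\ giso (M s) (greg R (\dim (Span s))).

Record shom (M N : sheaf) := SHom {
  shom_at :> forall s, ghom (M s) (N s);
  shom_res : forall s t (h : fle t s) x,
    shom_at t (res M h x) = res N h (shom_at s x) }.

Definition siso (M N : sheaf) : Prop :=
  exists (f : shom M N) (g : shom N M),
    (forall s, cancel (f s) (g s)) /\ (forall s, cancel (g s) (f s)).

Program Definition szero : sheaf :=
  @Sheaf (fun s => gzero R (\dim (Span s))) (fun _ _ _ _ => 0) _ _ _ _ _.
Next Obligation. by rewrite scaler0 addr0. Qed.
Next Obligation. by rewrite [x]thinmx0. Qed.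
Next Obligation. by exists 0%N, (fun=> 0) => x; exists [ffun=> 0]; rewrite big_ord0 [x]thinmx0. Qed.

Program Definition sadd (M N : sheaf) : sheaf :=
  @Sheaf (fun s => gadd (M s) (N s))
    (fun s t h x => (res M h x.1, res N h x.2)) _ _ _ _ _.
Next Obligation. by rewrite !res_semilinear. Qed.
Next Obligation. by split; apply: res_deg. Qed.
Next Obligation. by rewrite !res_id. Qed.
Next Obligation. by rewrite !(res_comp _ _ h''). Qed.
Next Obligation. exact: gadd_fg (sheaf_fg M s) (sheaf_fg N s). Qed.

Definition sdsum m (N : 'I_m -> sheaf) : sheaf :=
  \big[sadd/szero]_(i < m) N i.

Program Definition sshift (k : int) (M : sheaf) : sheaf :=
  @Sheaf (fun s => gshift k (M s)) (fun s t h x => res M h x) _ _ _ _ _.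
Next Obligation. exact: res_semilinear. Qed.
Next Obligation. exact: res_deg. Qed.
Next Obligation. exact: res_id. Qed.
Next Obligation. exact: res_comp. Qed.
Next Obligation. exact: sheaf_fg. Qed.

Definition is_zero_sheaf (M : sheaf) : Prop := forall s (x : M s), x = 0.

(* In the category of flabby locally free modules. *)
Definition indecomposable (M : sheaf) : Prop :=
  [/\ frakM M, ~ is_zero_sheaf M
    & forall N1 N2, frakM N1 -> frakM N2 -> siso M (sadd N1 N2) ->
        is_zero_sheaf N1 \/ is_zero_sheaf N2].

End Sheaves.

(* Main.v *)
(* Choose a homogeneous basis of every stalk M_s, by induction on s, together
   with a labelling of the basis elements.  By flabbiness M_s maps onto the
   sections over the boundary of s, which split according to the labels on the
   proper faces.  Hence M_s is spanned by homogeneous elements which either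
   vanish on the boundary or restrict to sections of a single label, and a basis
   can be extracted from these by exchange.  An element vanishing on the boundary
   gets a new label of its own, the others keep the label of their restriction.
   The elements of a given label span a direct summand of M.  If the basis
   contains as many elements vanishing on the boundary as possible, the remaining
   ones are independent in M_s / A^+ M_s modulo the kernel of restriction to the
   boundary, and this makes the summands minimal. *)
Require Import Defs.
From HB Require Import structures.
From mathcomp Require Import all_boot all_order all_algebra.
From mathcomp Require Import generic_quotient ring_quotient.
From mathcomp Require Import boolp classical_sets reals.
From mathcomp Require Import mpoly.

Set Implicit Arguments.
Unset Strict Implicit.
Unset Printing Implicit Defensive.

Import Order.TTheory GRing.Theory Num.Theory.
Local Open Scope ring_scope.

(** * Homogeneous components in graded modules *)

Section HomogeneousComponents.
Variables (R : realType) (n : nat).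
Local Notation A := {mpoly R[n]}.
Variable M : gmod R n.
Implicit Types x y : M.

Lemma gdegN k x : gdeg k x -> gdeg k (- x).
Proof. by rewrite -[- x]add0r; apply: gdegB; apply: gdeg0. Qed.

Lemma gdegD k x y : gdeg k x -> gdeg k y -> gdeg k (x + y).
Proof. by move=> hx hy; rewrite -[y]opprK; apply/gdegB/gdegN. Qed.

Lemma gdeg_bigsum (I : Type) (r : seq I) (P : pred I) (F : I -> M) k :
  (forall i, P i -> gdeg k (F i)) -> gdeg k (\sum_(i <- r | P i) F i).
Proof. by move=> h; elim/big_ind: _ => //; [apply: gdeg0|apply: gdegD]. Qed.

(** Requiring [f] to vanish off a finite set makes the family unique, whereas [gdeg_sum] leaves it
    arbitrary outside the list [s]. *)
Definition hdecomp x (f : int -> M) : Prop :=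
  (forall k, gdeg k (f k)) /\
  exists2 s, uniq s & (forall k, k \notin s -> f k = 0) /\ x = \sum_(k <- s) f k.

Lemma hdecomp_ex x : exists f, hdecomp x f.
Proof.
have [s [f [us hf ->]]] := gdeg_sum x.
exists (fun k => if k \in s then f k else 0); split=> [k|].
  by case: ifP => // _; apply: gdeg0.
exists s => //; split=> [k /negPf -> //|].
by apply: eq_big_seq => k ->.
Qed.

Lemma sum_support (f : int -> M) (s s' : seq int) :
  uniq s -> uniq s' -> {subset s <= s'} -> (forall k, k \notin s -> f k = 0) ->
  \sum_(k <- s) f k = \sum_(k <- s') f k.
Proof.
move=> us us' ss' f0; rewrite [RHS](bigID (mem s)) /= [X in _ + X]big1 // addr0.
rewrite -[RHS]big_filter; apply: perm_big; apply: uniq_perm; rewrite ?filter_uniq // => k.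
by rewrite mem_filter andb_idr //; apply: ss'.
Qed.

Lemma hdecompB x y f g :
  hdecomp x f -> hdecomp y g -> hdecomp (x - y) (fun k => f k - g k).
Proof.
move=> [hf [s us [fs ->]]] [hg [t ut [gt ->]]].
split=> [k|]; first exact: gdegB.
exists (undup (s ++ t)); first exact: undup_uniq.
split=> [k|].
  by rewrite mem_undup mem_cat => /norP[/fs -> /gt ->]; rewrite subr0.
rewrite sumrB; congr (_ - _); apply: sum_support; rewrite ?undup_uniq // => k kk;
  by rewrite mem_undup mem_cat kk ?orbT.
Qed.

Lemma hdecomp0 f : hdecomp 0 f -> forall k, f k = 0.
Proof.
move=> [hf [s us [fs f0]]] k; have [ks|/fs //] := boolP (k \in s).
exact: (gdeg_direct us hf).
Qed.

(* The homogeneous component of degree k. *)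
Definition hc k x : M := projT1 (cid (hdecomp_ex x)) k.

Lemma hcP x : hdecomp x (hc^~ x).
Proof. exact: projT2 (cid (hdecomp_ex x)). Qed.

Lemma hc_eq x f : hdecomp x f -> forall k, hc k x = f k.
Proof.
move=> hf k; apply/eqP; rewrite -subr_eq0; apply/eqP.
by have := hdecompB (hcP x) hf; rewrite subrr => /hdecomp0.
Qed.

Lemma hc_gdeg k x : gdeg k (hc k x).
Proof. by have [] := hcP x. Qed.

Lemma hcB k : {morph hc k : x y / x - y}.
Proof. by move=> x y; rewrite (hc_eq (hdecompB (hcP x) (hcP y))). Qed.

HB.instance Definition _ k := GRing.isZmodMorphism.Build M M (hc k) (hcB k).

Lemma hc_sum x : exists2 s, uniq s & x = \sum_(k <- s) hc k x.
Proof. by have [_ [s us [_ e]]] := hcP x; exists s. Qed.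

Lemma hc_homog d k x : gdeg d x -> hc k x = if k == d then x else 0.
Proof.
move=> hx; rewrite (@hc_eq _ (fun k => if k == d then x else 0)) //; split.
  by move=> l; case: eqP => [-> //|_]; apply: gdeg0.
by exists [:: d] => //; split=> [l|]; rewrite ?inE ?big_seq1 ?eqxx // => /negPf ->.
Qed.

Lemma hc_id k x : gdeg k x -> hc k x = x.
Proof. by move=> /(hc_homog k) ->; rewrite eqxx. Qed.

End HomogeneousComponents.

(** Stated for additive maps because the restriction maps of a sheaf go between modules over
    different polynomial rings. *)
Lemma hc_morph (R : realType) n n' (M : gmod R n) (N : gmod R n') (f : M -> N) :
  f 0 = 0 -> {morph f : x y / x + y} ->
  (forall k x, gdeg k x -> gdeg k (f x)) ->
  forall k x, hc k (f x) = f (hc k x).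
Proof.
move=> f0 fD fdeg k x; apply: (@hc_eq _ _ _ _ (fun k => f (hc k x))).
have [hd [s us [hs e]]] := hcP x; split=> [l|]; first exact: fdeg.
exists s => //; split=> [l /hs -> //|].
by rewrite {1}e; apply: (big_morph _ fD f0).
Qed.

(** * Homogeneous bases and the exchange argument *)

Section Bases.
Variables (R : realType) (n : nat).
Local Notation A := {mpoly R[n]}.
Variable M : gmod R n.
Implicit Types x y : M.

Definition homogeneous x : Prop := exists k, gdeg k x.

Definition gbasis m (e : 'I_m -> M) : Prop :=
  [/\ forall i, homogeneous (e i),
      forall x, exists c : {ffun 'I_m -> A}, x = \sum_i c i *: e i &
      forall c : 'I_m -> A, \sum_i c i *: e i = 0 -> forall i, c i = 0].

Lemma gfree_gbasis : gfree M <-> exists m (e : 'I_m -> M), gbasis e.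
Proof.
split=> [[m [e [he hb]]]|[m [e [he hg hf]]]]; exists m, e.
  split=> // [x|c c0 i]; first by have [c []] := hb x; exists c.
  have [d [_ du]] := hb 0.
  have d1 : d = [ffun i => c i].
    by apply: du; rewrite -{1}c0; apply: eq_bigr => j _; rewrite ffunE.
  have d2 : d = [ffun=> 0].
    by apply: du; rewrite big1 // => j _; rewrite ffunE scale0r.
  by have /ffunP/(_ i) := etrans (esym d1) d2; rewrite !ffunE.
split=> // x; have [c hc] := hg x.
exists c; split=> // d hd; apply/ffunP => i; apply/eqP; rewrite -subr_eq0.
apply/eqP; apply: (hf (fun i => c i - d i)).
under eq_bigr do rewrite scalerBl.
by rewrite sumrB -hc -hd subrr.
Qed.

(* Coordinates; the zero vector when [x] is not in the span of [e]. *)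
Definition bco m (e : 'I_m -> M) x : {ffun 'I_m -> A} :=
  if pselect (exists c : {ffun 'I_m -> A}, x = \sum_i c i *: e i) is left h
  then projT1 (cid h) else [ffun=> 0].

Section OneBasis.
Variables (m : nat) (e : 'I_m -> M).
Hypothesis be : gbasis e.

Lemma bcoE x : x = \sum_i bco e x i *: e i.
Proof.
rewrite /bco; case: pselect => [h|[]]; first by case: (cid h).
by have [_ + _] := be; apply.
Qed.

Lemma bco_uniq x (c : 'I_m -> A) : x = \sum_i c i *: e i -> forall i, bco e x i = c i.
Proof.
move=> xc i; have [_ _ hf] := be; apply/eqP; rewrite -subr_eq0; apply/eqP.
apply: (hf (fun i => bco e x i - c i)); under eq_bigr do rewrite scalerBl.
by rewrite sumrB -bcoE -xc subrr.
Qed.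

Lemma bco_linear i a x y : bco e (a *: x + y) i = a * bco e x i + bco e y i.
Proof.
apply: (bco_uniq (c := fun i => a * bco e x i + bco e y i)).
under eq_bigr do rewrite scalerDl -scalerA.
by rewrite big_split /= -scaler_sumr -!bcoE.
Qed.

Lemma bco_e i j : bco e (e i) j = (j == i)%:R.
Proof.
apply: (bco_uniq (c := fun j => (j == i)%:R)); rewrite (bigD1 i) //= eqxx scale1r.
by rewrite big1 ?addr0 // => l /negPf ->; rewrite scale0r.
Qed.

Lemma bco0 i : bco e 0 i = 0.
Proof. by apply: (bco_uniq (c := fun=> 0)); rewrite big1 // => j _; rewrite scale0r. Qed.

Lemma bcoD i x y : bco e (x + y) i = bco e x i + bco e y i.
Proof. by rewrite -[x]scale1r bco_linear mul1r scale1r. Qed.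

Lemma bcoZ i a x : bco e (a *: x) i = a * bco e x i.
Proof. by rewrite -[a *: x]addr0 bco_linear bco0 addr0. Qed.

Lemma bco_sum i (I : Type) (r : seq I) (P : pred I) (F : I -> M) :
  bco e (\sum_(k <- r | P k) F k) i = \sum_(k <- r | P k) bco e (F k) i.
Proof. by apply: (big_morph (fun x => bco e x i)) => [x y|]; rewrite ?bcoD ?bco0. Qed.

Lemma gdegZ_supp k d (a : A) x : gdeg d x ->
  (forall l, l \in msupp a -> k = d + (2 * mdeg l)%N%:Z) -> gdeg k (a *: x).
Proof.
move=> hx hl; rewrite [a]mpolyE scaler_suml big_seq; apply: gdeg_bigsum => l la.
by rewrite (hl l la); apply: gdegZ => //; rewrite rpredZ // dhomogX.
Qed.

Lemma hc_scale x d k (a : A) : gdeg d x -> exists2 a' : A, hc k (a *: x) = a' *: x &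
  forall l, l \in msupp a' -> k = d + (2 * mdeg l)%N%:Z.
Proof.
move=> hx.
(* At most one [h] qualifies; the sum is empty when [k - d] is negative, odd or too large. *)
exists (\sum_(h < msize a | k == d + (2 * h)%N%:Z) pihomog mdeg h a).
  rewrite {1}(pihomog_partitionE (mf := mdeg) (leqnn (msize a))).
  rewrite !scaler_suml raddf_sum [RHS]big_mkcond /=; apply: eq_bigr => h _.
  by rewrite (hc_homog _ (gdegZ (pihomogP mdeg h a) hx)).
move=> l; rewrite mcoeff_msupp raddf_sum /= => hl.
have : ~~ [forall h : 'I_(msize a), (k == d + (2 * h)%N%:Z) ==>
     ((pihomog mdeg h a)@_l == 0)].
  apply: contra hl => /forallP h0; rewrite big1 // => h hh.
  by apply/eqP; have := h0 h; rewrite hh.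
move=> /forallPn[h]; rewrite negb_imply -mcoeff_msupp => /andP[/eqP ->].
by move=> /(dhomog_mf (pihomogP mdeg h a)) /= ->.
Qed.

(** Taking components of degree [k] in the expansion of [x] gives a second expansion of [x], with
    homogeneous coefficients; by uniqueness of coordinates the two agree. *)
Lemma bco_homog x k i d : gdeg k x -> gdeg d (e i) ->
  forall l, l \in msupp (bco e x i) -> k = d + (2 * mdeg l)%N%:Z.
Proof.
move=> hx hi; have [he _ _] := be.
have /choice[dg hdg] : forall i, exists d, gdeg d (e i) by [].
have /choice[c hc'] i' : exists a' : A,
    hc k (bco e x i' *: e i') = a' *: e i' /\
    forall d, gdeg d (e i') -> forall l, l \in msupp a' -> k = d + (2 * mdeg l)%N%:Z.
  have [a' h1 h2] := hc_scale k (bco e x i') (hdg i'); exists a'; split=> // d'.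
  (* A nonzero element has only one degree, and a basis element is nonzero because its own
     coordinate is 1. *)
  have [ez _|ez hd'] := eqVneq (e i') 0; last first.
    suff -> : d' = dg i' by [].
    have := hc_homog d' (hdg i'); rewrite (hc_id hd').
    by case: (d' =P dg i') => // _ /eqP; rewrite (negPf ez).
  move: h2; have [_ _ hf] := be.
  have := bco_e i' i'; rewrite ez bco0 eqxx => /eqP.
  by rewrite eq_sym oner_eq0.
have -> : bco e x i = c i.
  apply: bco_uniq; rewrite -{1}(hc_id hx) {1}[x]bcoE raddf_sum.
  by apply: eq_bigr => j _; have [] := hc' j.
by have [_ /(_ _ hi)] := hc' i.
Qed.

Lemma bco_gdeg x k i : gdeg k x -> gdeg k (bco e x i *: e i).
Proof.
move=> hx; have [he _ _] := be; have [d hi] := he i.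
exact: gdegZ_supp hi (bco_homog hx hi).
Qed.

(** A nonzero constant term forces [x] and [e i] to have the same degree, so the coordinate is an
    invertible scalar. This makes exchange possible over a polynomial ring. *)
Lemma bco_const x i : homogeneous x -> (bco e x i)@_0%MM != 0 ->
  bco e x i = ((bco e x i)@_0%MM)%:MP.
Proof.
move=> [k hx] c0; have [he _ _] := be; have [d hi] := he i.
have hl := bco_homog hx hi; have := hl 0%MM; rewrite mcoeff_msupp => /(_ c0).
rewrite mdeg0 muln0 addr0 => ekd; subst k.
apply/mpolyP => l; rewrite mcoeffC; have [->|l0] := eqVneq l 0%MM.
  by rewrite mulr1.
rewrite mulr0; apply: memN_msupp_eq0; apply/negP => /hl/esym/eqP.
rewrite -[X in _ == X]addr0 (inj_eq (addrI d)) eqz_nat muln_eq0 /= mdeg_eq0.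
by rewrite (negPf l0).
Qed.

Definition exchange x j i := if i == j then x else e i.

Lemma gbasis_exchange x j : homogeneous x -> (bco e x j)@_0%MM != 0 ->
  gbasis (exchange x j).
Proof.
move=> hx c0; have [he hg hf] := be.
set u := (bco e x j)@_0%MM in c0; have eu : bco e x j = u%:MP by exact: bco_const.
have esum (c : 'I_m -> A) : \sum_i c i *: exchange x j i =
    \sum_i (c j * bco e x i + (i != j)%:R * c i) *: e i.
  under [RHS]eq_bigr do rewrite scalerDl -!scalerA.
  rewrite big_split /= -scaler_sumr -bcoE (bigD1 j) //= /exchange eqxx.
  congr (_ + _); rewrite [RHS](bigD1 j) //= eqxx scale0r add0r.
  by apply: eq_bigr => i ij; rewrite (negPf ij) scale1r.
split.
- by move=> i; rewrite /exchange; case: eqP.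
(* [v] is the new coordinate along [x]: the old [j]-th coordinate divided by the unit [u]. *)
- move=> y; pose v : A := bco e y j * (u^-1)%:MP.
  exists [ffun i => if i == j then v else bco e y i - v * bco e x i].
  rewrite esum {1}[y]bcoE; apply: eq_bigr => i _; rewrite !ffunE eqxx.
  have [->|_] := eqVneq i j; last by rewrite mul1r addrCA subrr addr0.
  by rewrite mul0r addr0 eu /v -mulrA -rmorphM /= mulVf // mulr1.
- move=> c; rewrite esum => /hf h.
  have cj : c j = 0.
    have := h j; rewrite eqxx mul0r addr0 eu => /eqP; rewrite mulf_eq0.
    by rewrite mpolyC_eq0 (negPf c0) orbF => /eqP.
  move=> i; have [-> //|ij] := eqVneq i j.
  by have := h i; rewrite cj mul0r add0r ij mul1r.
Qed.

End OneBasis.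

(* Maximizing the number of basis elements in [K] makes the others independent
   in M / A^+ M modulo the image of [K]. *)
Lemma gbasis_adapted m (K S : M -> Prop) :
  (exists e : 'I_m -> M, gbasis e) ->
  (forall x, homogeneous x -> exists2 ys : seq M,
     (forall y, y \in ys -> homogeneous y /\ S y) & x = \sum_(y <- ys) y) ->
  (forall x, K x -> S x) -> (forall k x, K x -> K (hc k x)) ->
  exists e : 'I_m -> M, [/\ gbasis e, forall i, S (e i) &
    forall x, K x -> forall i, ~ K (e i) -> (bco e x i)@_0%MM = 0].
Proof.
move=> [e0 be0] Sspan KS Khc.
have [e [be Se]] : exists e : 'I_m -> M, gbasis e /\ forall i, S (e i).
  have [r] := ubnP #|[set i | ~~ `[< S (e0 i) >]]|.
  elim: r e0 be0 => // r IH e be; rewrite ltnS => hr.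
  have [Se|/existsNP[j nSj]] := pselect (forall i, S (e i)); first by exists e.
  have [he _ _] := be; have [ys hy ey] := Sspan _ (he j).
  (* The [j]-th coordinate of [e j] is 1, so some term of [ys] has a nonzero constant term there and
     can replace [e j]. *)
  have : (bco e (e j) j)@_0%MM != 0 by rewrite bco_e // eqxx mcoeff1 eqxx oner_eq0.
  rewrite {1}ey bco_sum // raddf_sum /= => nz.
  have /hasP[y /hy[hyi Syi] yi] : has (fun y => (bco e y j)@_0%MM != 0) ys.
    apply: contraR nz => /hasPn h; rewrite big1_seq // => y /= /h.
    by rewrite negbK => /eqP.
  apply: (IH _ (gbasis_exchange be hyi yi)); apply: leq_trans hr; apply: proper_card.
  apply/properP; split; last first.
    exists j; rewrite inE; first exact/asboolPn.
    by rewrite negbK /exchange eqxx; apply/asboolP.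
  apply/fintype.subsetP => l; rewrite !inE /exchange; case: eqP => // _.
  by move=> /asboolPn.
(* Elements outside [K] are now traded for elements of [K]; the family stays in [S], which contains
   [K]. *)
have [r] := ubnP #|[set i | ~~ `[< K (e i) >]]|.
elim: r e be Se => // r IH e be Se; rewrite ltnS => hr.
have [h|] := pselect (forall x, homogeneous x -> K x -> forall i, ~ K (e i) ->
    (bco e x i)@_0%MM = 0).
  exists e; split=> // x Kx i nK; have [s _ ->] := hc_sum x.
  rewrite bco_sum // raddf_sum big1 //= => k _; apply: h => //; last exact: Khc.
  by exists k; apply: hc_gdeg.
move=> /existsNP[x /not_implyP[hx /not_implyP[Kx /existsNP[j /not_implyP[nKj /eqP xj]]]]].
apply: (IH _ (gbasis_exchange be hx xj)).
  by move=> i; rewrite /exchange; case: eqP => // _; apply: KS.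
apply: leq_trans hr; apply: proper_card.
apply/properP; split; last first.
  exists j; rewrite inE; first exact/asboolPn.
  by rewrite negbK /exchange eqxx; apply/asboolP.
apply/fintype.subsetP => l; rewrite !inE /exchange; case: eqP => // _.
by move=> /asboolPn.
Qed.

End Bases.

(** * The face order of a fan *)

Section FaceOrder.
Variables (R : realType) (V : vectType R) (Phi : fan V).
Implicit Types s t u : Phi.

(** When one cone contains the other, their intersection is the smaller one, and [fan_inter] makes
    it a face. *)
Lemma fleE t s : fle t s <-> (cone t `<=` cone s)%classic.
Proof.
split=> [/asboolP[l _ ->] v []//|h]; apply/asboolP.
by have [] := fan_inter s t; rewrite (setIidr h).
Qed.

Lemma fle_refl s : fle s s.
Proof. exact/fleE. Qed.

Lemma fle_trans s t u : fle u t -> fle t s -> fle u s.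
Proof. by move=> /fleE h /fleE h'; apply/fleE; apply: subset_trans h'. Qed.

Lemma fle_anti s t : fle s t -> fle t s -> s = t.
Proof. by move=> /fleE h /fleE h'; apply/fan_inj/seteqP. Qed.

Definition flt t s := fle t s && (t != s).

Lemma in_boundary t s : (t \in boundary s) = flt t s.
Proof. by rewrite inE. Qed.

Lemma fltW t s : flt t s -> fle t s.
Proof. by case/andP. Qed.

Lemma flt_fle_trans s t u : flt u t -> fle t s -> flt u s.
Proof.
move=> /andP[ut nut] ts; rewrite /flt (fle_trans ut ts).
by apply: contra nut => /eqP us; subst u; rewrite (fle_anti ut ts).
Qed.

Lemma fle_flt_trans s t u : fle u t -> flt t s -> flt u s.
Proof.
move=> ut /andP[ts nts]; rewrite /flt (fle_trans ut ts).
by apply: contra nts => /eqP us; subst u; rewrite (fle_anti ut ts).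
Qed.

Lemma fopen_boundary s : fopen (boundary s).
Proof. by move=> t u; rewrite !in_boundary => ts ut; apply: fle_flt_trans ts. Qed.

Lemma boundary_proper t s : flt t s -> (#|boundary t| < #|boundary s|)%N.
Proof.
move=> ts; apply: proper_card; apply/properP; split.
  apply/fintype.subsetP => u; rewrite !in_boundary => ut.
  exact: flt_fle_trans (fltW ts).
by exists t; rewrite in_boundary // /flt eqxx andbF.
Qed.

(** The number of proper faces drops on passing to a proper face and serves as induction measure. *)
Lemma face_ind (P : Phi -> Prop) :
  (forall s, (forall t, flt t s -> P t) -> P s) -> forall s, P s.
Proof.
move=> h s; have [k] := ubnP #|boundary s|; elim: k s => // k IH s hs.
apply: h => t /boundary_proper ts; apply: IH; exact: leq_trans ts _.
Qed.

End FaceOrder.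

(** * Restriction of polynomials and constant terms *)

Section Restr.
Variables (R : realType) (V : vectType R).
Implicit Types W : {vspace V}.

Lemma meval_origin n (p : {mpoly R[n]}) : p.@[fun=> 0] = p@_0%MM.
Proof.
rewrite mevalE; have h0 l : l != 0%MM :> 'X_{1..n} -> \prod_(i < n) (0 : R) ^+ l i = 0.
  move=> l0; have /forallPn[i li] : ~~ [forall i, l i == 0%N].
    by apply: contra l0 => /forallP h; apply/eqP/mnmP => i; rewrite mnmE; apply/eqP.
  by rewrite (bigD1 i) //= expr0n (negPf li) mul0r.
have [/[dup] h|h] := boolP (0%MM \in msupp p); last first.
  rewrite (memN_msupp_eq0 h) big1_seq // => l /= lp; rewrite h0 ?mulr0 //.
  by apply: contraNneq h => <-.
move=> _; rewrite (bigD1_seq 0%MM) ?msupp_uniq //= big1 ?mulr1.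
  by rewrite big1 ?addr0 // => l /h0 ->; rewrite mulr0.
by move=> i _; rewrite mnmE expr0.
Qed.

(** The constant term is the value at the origin, which lies in every subspace. *)
Lemma restr_const W W' (p : {mpoly R[\dim W]}) : (restr W W' p)@_0%MM = p@_0%MM.
Proof.
rewrite -!meval_origin.
have e0 U (q : {mpoly R[\dim U]}) :
    q.@[fun=> 0] = q.@[fun i => coord (vbasis U) i 0].
  by apply: meval_eq => i; rewrite linear0.
by rewrite !e0 restr_eval // mem0v.
Qed.

Lemma restr_id W p : restr W W p = p.
Proof.
rewrite -[RHS]comp_mpoly_id; congr comp_mpoly; apply: eq_from_tnth => i.
rewrite !tnth_mktuple (bigD1 i) //= coord_free ?(basis_free (vbasisP W)) // eqxx.
rewrite scale1r big1 ?addr0 // => j ji.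
by rewrite coord_free ?(basis_free (vbasisP W)) // (negPf ji) scale0r.
Qed.

(** [coord] is linear on the whole space, so [restr W fullv] extends polynomial functions from [W].
    This section of the restriction lifts scalars of a stalk to A. *)
Lemma restrK W p : restr fullv W (restr W fullv p) = p.
Proof. by rewrite restr_comp ?subvf // restr_id. Qed.

End Restr.

(** * Labelled bases of the stalks, built by induction on faces *)

Section Decomposition.
Variables (R : realType) (V : vectType R) (Phi : fan V) (M : sheaf Phi).
Variable m : Phi -> nat.
Hypothesis flM : flabby M.
Hypothesis frM : forall s, exists e : 'I_(m s) -> M s, gbasis e.
Implicit Types s t u : Phi.

Local Notation res := (res (s0 := M)).

(** The boundary is a subfan, so flabbiness extends the section to the whole fan; the value at [s]
    is a preimage. *)
Lemma to_boundary_surj s (y : sect M (boundary s)) :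
  exists x, to_boundary (x : rscal (restr fullv (Span s)) (M s)) = y.
Proof.
have [z zy] := flM (@fopen_boundary _ _ _ s) y.
exists (sect_at z (finset.in_setT s)); apply: sectP => t tU /=.
rewrite -zy /= (sect_compat _ _ (finset.in_setT t)).
by congr (sect_at z); apply: Prop_irrelevance.
Qed.

(* The label (s, i) stands for the summand generated by the i-th basis element
   at s; it is in use only if that element is labelled by itself. *)
Definition label := {s : Phi & 'I_(m s)}.
Definition lab_of s i : label := Tagged (fun s => 'I_(m s)) (i : 'I_(m s)).

Definition based s := (('I_(m s) -> M s) * ('I_(m s) -> label))%type.

(** The projection onto the span of the basis elements labelled [l], along the other ones. *)
Definition lproj s (d : based s) (l : label) (x : M s) : M s :=
  \sum_(i | d.2 i == l) bco d.1 x i *: d.1 i.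

Section LProj.
Variables (s : Phi) (d : based s).
Hypothesis bd : gbasis d.1.

Lemma lproj_linear l : linear (lproj d l).
Proof.
move=> a x y; rewrite /lproj scaler_sumr -big_split /=; apply: eq_bigr => i _.
by rewrite bco_linear // scalerDl scalerA.
Qed.

Lemma lproj0 l : lproj d l 0 = 0.
Proof. by rewrite /lproj big1 // => i _; rewrite bco0 // scale0r. Qed.

Lemma lprojD l : {morph lproj d l : x y / x + y}.
Proof. by move=> x y; rewrite -[x]scale1r lproj_linear !scale1r. Qed.

Lemma lprojZ l a x : lproj d l (a *: x) = a *: lproj d l x.
Proof. by rewrite -[_ *: x]addr0 lproj_linear lproj0 addr0. Qed.

Lemma lproj_bigsum l (I : Type) (r : seq I) (P : pred I) F :
  lproj d l (\sum_(i <- r | P i) F i) = \sum_(i <- r | P i) lproj d l (F i).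
Proof. exact: (big_morph _ (@lprojD l) (@lproj0 l)). Qed.

Lemma lproj_co l x i : bco d.1 (lproj d l x) i = if d.2 i == l then bco d.1 x i else 0.
Proof.
apply: (bco_uniq bd (c := fun i => if d.2 i == l then bco d.1 x i else 0)).
by rewrite /lproj big_mkcond; apply: eq_bigr => j _; case: ifP; rewrite ?scale0r.
Qed.

Lemma lproj_e l i : lproj d l (d.1 i) = if d.2 i == l then d.1 i else 0.
Proof.
rewrite [RHS](bcoE bd) [LHS](bcoE bd); apply: eq_bigr => j _; congr (_ *: _).
rewrite lproj_co bco_e //; have [->|ji] := eqVneq j i.
  by case: ifP; rewrite ?bco0 ?bco_e // eqxx.
by case: ifP => _; case: ifP => _; rewrite ?bco0 ?bco_e // (negPf ji).
Qed.

Lemma lproj_orth l l' x : lproj d l (lproj d l' x) = if l == l' then lproj d l x else 0.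
Proof.
rewrite [LHS](bcoE bd); under eq_bigr do rewrite !lproj_co.
case: eqVneq => [->|nl]; last first.
  rewrite big1 // => i _; case: eqP => [->|_]; rewrite ?(negPf nl) ?scale0r //.
by rewrite /lproj [RHS]big_mkcond; apply: eq_bigr => i _; case: (d.2 i == l'); rewrite ?scale0r.
Qed.

Lemma lproj_sum x : \sum_l lproj d l x = x.
Proof.
rewrite [RHS](bcoE bd) (exchange_big_dep predT) //=; apply: eq_bigr => i _.
by rewrite (big_pred1 (d.2 i)) // => l; rewrite eq_sym.
Qed.

Lemma lproj_deg l k x : gdeg k x -> gdeg k (lproj d l x).
Proof. by move=> hx; apply: gdeg_bigsum => i _; apply: bco_gdeg. Qed.

End LProj.

Definition bvanish s (x : M s) : Prop :=
  forall t (h : fle t s), t != s -> res h x = 0.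

(** The invariant of the induction. [good_res] makes the span of each label stable under
    restriction, [good_lab] ties a label to the cone where it first appears, and [good_min] yields
    the boundary condition for minimal sheaves. *)
Record good (s : Phi) (d : forall t, based t) : Prop := Good {
  good_basis : gbasis (d s).1;
  good_res : forall i t (h : fle t s), t != s ->
    lproj (d t) ((d s).2 i) (res h ((d s).1 i)) = res h ((d s).1 i);
  good_lab : forall i, ((d s).2 i = lab_of i /\ bvanish ((d s).1 i)) \/
    (flt (tag ((d s).2 i)) s /\
     (d (tag ((d s).2 i))).2 (tagged ((d s).2 i)) = (d s).2 i);
  good_min : forall x, bvanish x -> forall i, (d s).2 i <> lab_of i ->
    (bco (d s).1 x i)@_0%MM = 0 }.

(** [good s] looks at the family on the faces of [s] only, so later choices at other cones do not
    disturb it. *)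
Lemma good_congr s d d' : (forall t, fle t s -> d' t = d t) -> good s d -> good s d'.
Proof.
move=> e [h1 h2 h3 h4]; have es := e _ (fle_refl s); split; rewrite es //.
  by move=> i t h; rewrite e //; apply: h2.
by move=> i; case: (h3 i) => [|[l1 l2]]; [left|right]; rewrite // e ?(fltW l1).
Qed.

Lemma good_tag s d i : good s d -> fle (tag ((d s).2 i)) s.
Proof. by move=> /good_lab/(_ i)[[-> _]|[/fltW]//]; apply: fle_refl. Qed.

Lemma good_root s d i : good s d ->
  (d (tag ((d s).2 i))).2 (tagged ((d s).2 i)) = (d s).2 i.
Proof. by move=> /good_lab/(_ i)[[e _]|[]//]; rewrite e. Qed.

(** By [good_res] each basis element restricts into the span of its own label. The images of the
    projections are therefore subsheaves. *)
Lemma lproj_res s t (h : fle t s) d l x : good s d -> good t d ->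
  res h (lproj (d s) l x) = lproj (d t) l (res h x).
Proof.
have [e gs gt|ts gs gt] := eqVneq t s; first by subst t; rewrite !res_id.
have bs := good_basis gs; have bt := good_basis gt.
have Fr := (big_morph _ (resD h) (res0 M h)).
rewrite {2}[x](bcoE bs) /lproj !Fr -/(lproj (d t) l _) lproj_bigsum //.
rewrite big_mkcond; apply: eq_bigr => i _; rewrite !resZ lprojZ //.
rewrite -(good_res gs i h ts) lproj_orth // (good_res gs i h ts) [l == _]eq_sym.
by case: ifP; rewrite ?scaler0 // => /eqP <-; rewrite (good_res gs i h ts).
Qed.

(** The label components of the restriction of [x] are sections over the boundary, hence lift to
    [M s]. The lifts add up to [x] modulo an element vanishing on the boundary. *)
Lemma boundary_span s d (k : int) (x : M s) :
  (forall t, flt t s -> good t d) -> gdeg k x ->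
  exists2 ys : seq (M s),
    (forall y, y \in ys -> homogeneous y /\ (bvanish y \/
      exists l, [/\ flt (tag l) s, (d (tag l)).2 (tagged l) = l &
        forall t (h : fle t s), t != s -> lproj (d t) l (res h y) = res h y])) &
    x = \sum_(y <- ys) y.
Proof.
move=> gd hx.
have compat l t u (tU : t \in boundary s) (uU : u \in boundary s) (h : fle u t) :
    res h (lproj (d t) l (res (boundary_fle tU) x)) =
    lproj (d u) l (res (boundary_fle uU) x).
  rewrite lproj_res; [|by apply: gd; rewrite -in_boundary..].
  by rewrite (res_comp _ _ (boundary_fle uU)).
have /choice[z hz] : forall l, exists z : M s, gdeg k z /\
    forall t (h : fle t s), t != s -> res h z = lproj (d t) l (res h x).
  move=> l; have [z ez] := to_boundary_surj (Sect (@compat l)).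
  (* Keeping only degree [k] does not change the restriction of the lift, which is already of degree
     [k]. *)
  exists (hc k (z : M s)); split=> [|t h ts]; first exact: hc_gdeg.
  rewrite -(hc_morph (res0 M h) (resD h) (res_deg h)).
  have tU : t \in boundary s by rewrite in_boundary /flt h.
  have := congr1 (fun y => sect_at y tU) ez; rewrite /=.
  rewrite (Prop_irrelevance (boundary_fle tU) h) => ->.
  apply: hc_id; apply: lproj_deg; last exact: res_deg.
  by apply: good_basis; apply: gd; rewrite -in_boundary.
exists ((x - \sum_l z l) :: [seq z l | l <- enum {: label}]); last first.
  by rewrite big_cons big_map big_enum subrK.
move=> y; rewrite inE => /orP[/eqP->|/mapP[l _ ->]]; split.
- exists k; apply: gdegB => //; apply: gdeg_bigsum => j _.
  by have [] := hz j.
- left=> t h ts; rewrite resD resN (big_morph _ (resD h) (res0 M h)).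
  under eq_bigr => l _ do rewrite (hz l).2 //.
  by rewrite lproj_sum ?subrr //; apply: good_basis; apply: gd; rewrite /flt h.
- by exists k; have [] := hz l.
(* By [good_tag] and [good_root], a label in use on a proper face is attached to a proper face of
   [s] and labelled by itself there. For any other [l] the lift [z l] vanishes on the boundary. *)
have [ls|nls] := boolP (flt (tag l) s && ((d (tag l)).2 (tagged l) == l)).
  move/andP: ls => [ls /eqP ll]; right; exists l; split=> // t h ts.
  rewrite (hz l).2 // lproj_orth ?eqxx //; apply: good_basis; apply: gd.
  by rewrite /flt h.
left=> t h ts; rewrite (hz l).2 // /lproj big1 // => i /eqP il.
have gt : good t d by apply: gd; rewrite /flt h.
case/negP: nls; have := good_tag i gt; have := good_root i gt; rewrite il => -> lt.
by rewrite eqxx andbT (fle_flt_trans lt) // /flt h.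
Qed.

(** [gbasis_adapted] is applied with [bvanish] as [K]; [boundary_span] provides the spanning set.
    Quantifying over [d'] lets [b] be inserted into a family afterwards. *)
Lemma good_extend s d : (forall t, flt t s -> good t d) ->
  exists b : based s, forall d', (forall t, flt t s -> d' t = d t) ->
    d' s = b -> good s d'.
Proof.
move=> gd; pose S (x : M s) := bvanish x \/
      exists l, [/\ flt (tag l) s, (d (tag l)).2 (tagged l) = l &
        forall t (h : fle t s), t != s -> lproj (d t) l (res h x) = res h x].
have [e [be Se he]] : exists e : 'I_(m s) -> M s, [/\ gbasis e, forall i, S (e i) &
    forall x, bvanish x -> forall i, ~ bvanish (e i) -> (bco e x i)@_0%MM = 0].
  apply: gbasis_adapted => //.
  - by move=> x [k hk]; apply: boundary_span hk.
  - by move=> x; left.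
  - move=> k x hx t h ts; rewrite -(hc_morph (res0 M h) (resD h) (res_deg h)).
    by rewrite hx // raddf0.
(* Vanishing is tested first, so an inherited label always belongs to an element that does not
   vanish on the boundary, as [good_min] requires. *)
have /choice[lab hlab] i : exists l, (bvanish (e i) /\ l = lab_of i) \/
   (~ bvanish (e i) /\ [/\ flt (tag l) s, (d (tag l)).2 (tagged l) = l &
        forall t (h : fle t s), t != s -> lproj (d t) l (res h (e i)) = res h (e i)]).
  have [v|v] := pselect (bvanish (e i)); first by exists (lab_of i); left.
  by case: (Se i) => // -[l hl]; exists l; right.
exists (e, lab) => d' d'd d's; split; rewrite d's //=.
- move=> i t h ts; have tls : flt t s by rewrite /flt h.
  rewrite d'd //; case: (hlab i) => [[v _]|[_ [_ _]]]; last exact.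
  by rewrite v // lproj0 //; apply: good_basis; apply: gd.
- move=> i; case: (hlab i) => [[v ->]|[_ [h1 h2 _]]]; [by left|right].
  by rewrite d'd.
- move=> x hx i hi; apply: he => //; move: hi.
  by case: (hlab i) => [[_ ->]|[]].
Qed.

Lemma good_ex : exists d, forall s, good s d.
Proof.
have ext (d : forall t, based t) (U : {set Phi}) :
    fopen U -> (forall s, s \in U -> good s d) -> exists d, forall s, good s d.
  have [k] := ubnP #|~: U|%SET; elim: k d U => // k IH d U; rewrite ltnS => hU oU gU.
  have [dU|/existsNP[s0 /negP s0U]] := pselect (forall s, s \in U).
    by exists d => s; apply: gU.
  (* A cone outside [U] with the fewest proper faces has all of them in [U]. *)
  case: (@arg_minnP Phi s0 (fun t => t \notin U) (fun t => #|boundary t|) s0U) => s sU smin.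
  have sb t : flt t s -> t \in U.
    move=> ts; apply: contraLR (boundary_proper ts) => tU.
    by rewrite -leqNgt; apply: smin.
  have [b hb] := good_extend (fun t ts => gU t (sb t ts)).
  have dU t : t \in U -> dfwith d b t = d t.
    by move=> tU; apply: dfwith_out; apply: contraNneq sU => ->.
  apply: (IH (dfwith d b) (s |: U)%SET).
  - apply: leq_trans hU; apply: proper_card; apply/properP.
    split; first by rewrite finset.setCS finset.subsetUr.
    by exists s; rewrite !inE ?eqxx.
  - move=> t u; rewrite !finset.in_setU1 => /orP[/eqP->|tU] ut; last by rewrite (oU t u tU ut) orbT.
    by have [//|us] := eqVneq u s; apply: sb; rewrite /flt ut.
  - move=> t; rewrite !finset.in_setU1 => /orP[/eqP->|tU].
      by apply: hb => [u us|]; [apply/dU/sb|apply: dfwith_in].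
    apply: good_congr (gU _ tU) => u ut; apply: dU; exact: oU ut.
(* Default values: the induction starts from the empty subfan, where nothing is required. *)
pose b0 s : based s := (projT1 (cid (frM s)), @lab_of s).
by apply: (ext b0 finset.set0) => [s t|s]; rewrite inE.
Qed.

End Decomposition.

Definition mk_linear (A : nzRingType) (M N : lmodType A) (f : M -> N)
  (fl : linear f) : {linear M -> N} := HB.pack f (GRing.isLinear.Build A M N *:%R f fl).

(** * The graded module of fixed points of an idempotent *)

Section FixedPoints.
Variables (R : realType) (n : nat).
Local Notation A := {mpoly R[n]}.
Variables (N : gmod R n) (p : N -> N).

(** Carrying [pl] in the predicate lets its submodule structure be inferred from the predicate
    alone. *)
Definition fixpt (pl : linear p) : {pred N} := fun x => p x == x.

Section Linear.
Hypothesis pl : linear p.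

Fact fixpt_closed : submod_closed (fixpt pl).
Proof.
split=> [|a x y /eqP ex /eqP ey]; apply/eqP; last by rewrite pl ex ey.
by have := pl (-1) 0 0; rewrite scaler0 addr0 scaleN1r addNr.
Qed.

HB.instance Definition _ := GRing.isSubmodClosed.Build A N (fixpt pl) fixpt_closed.

Record fixed := Fixed { fval : N; fvalP : fval \in fixpt pl }.
HB.instance Definition _ := [isSub for fval].
HB.instance Definition _ := [Choice of fixed by <:].
HB.instance Definition _ := [SubChoice_isSubLmodule of fixed by <:].

Hypothesis pp : forall x, p (p x) = p x.
Hypothesis pdeg : forall k x, gdeg k x -> gdeg k (p x).

Lemma fval_inj : injective fval.
Proof. exact: val_inj. Qed.

Lemma fvalK (x : fixed) : p (fval x) = fval x.
Proof. exact/eqP/fvalP. Qed.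

Fact fixer_subproof x : p x \in fixpt pl.
Proof. exact/eqP. Qed.

Definition fixer x : fixed := Fixed (fixer_subproof x).

Fact fixer_linear : linear fixer.
Proof. by move=> a x y; apply: fval_inj; rewrite /= pl. Qed.

Lemma fval_sum (I : Type) (r : seq I) (P : pred I) (F : I -> fixed) :
  fval (\sum_(i <- r | P i) F i) = \sum_(i <- r | P i) fval (F i).
Proof. exact: (raddf_sum (val : fixed -> N)). Qed.

Variable t : int.
Let deg k (x : fixed) : Prop := gdeg (k + t) (fval x).

Fact gfix_deg0 k : deg k 0.
Proof. exact: gdeg0. Qed.

Fact gfix_degB k x y : deg k x -> deg k y -> deg k (x - y).
Proof. exact: gdegB. Qed.

Fact gfix_degZ k d (a : A) x :
  a \is d.-homog -> deg k x -> deg (k + (2 * d)%N%:Z) (a *: x).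
Proof. by move=> ha; rewrite /deg addrAC; apply: gdegZ. Qed.

Fact gfix_deg_sum x : exists (s : seq int) (f : int -> fixed),
  [/\ uniq s, forall k, deg k (f k) & x = \sum_(k <- s) f k].
Proof.
have [s us e] := hc_sum (fval x).
exists [seq k - t | k <- s], (fun k => fixer (hc (k + t) (fval x))); split.
- by rewrite map_inj_uniq //; apply: addIr.
- by move=> k; apply/pdeg/hc_gdeg.
- rewrite big_map; apply: fval_inj; rewrite fval_sum /= -{1}fvalK {1}e.
  rewrite -[LHS]/(mk_linear pl _) raddf_sum; apply: eq_bigr => k _ /=.
  by rewrite subrK.
Qed.

Fact gfix_deg_direct (s : seq int) (f : int -> fixed) :
  uniq s -> (forall k, deg k (f k)) -> \sum_(k <- s) f k = 0 ->
  forall k, k \in s -> f k = 0.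
Proof.
move=> us hf f0 k ks; apply: fval_inj.
apply: (@gdeg_direct _ _ (gshift t N) s (fun k => fval (f k)) us _ _ k ks) => //.
by rewrite -fval_sum f0.
Qed.

(* The grading is shifted by [t], so that both L^s and its shift can be taken of
   this form. *)
Definition gfix : gmod R n := @GMod R n fixed deg
  gfix_deg0 gfix_degB gfix_degZ gfix_deg_sum gfix_deg_direct.

End Linear.
End FixedPoints.

(** * Morphisms of sheaves and finite direct sums *)

Section SheafMaps.
Variables (R : realType) (V : vectType R) (Phi : fan V).
Implicit Types (M N : sheaf Phi).

Local Notation res N := (res (s0 := N)).

Definition mk_shom M N (f : forall s, M s -> N s) (fl : forall s, linear (f s))
  (fd : forall s k x, gdeg k x -> gdeg k (f s x))
  (fr : forall s t (h : fle t s) x, f t (res M h x) = res N h (f s x)) : shom M N :=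
  @SHom _ _ _ M N (fun s => @GHom _ _ (M s) (N s) (mk_linear (fl s)) (fd s)) fr.

(** [sdsum] is an iterated binary sum without indexed components. The induction carries two
    substitutes: an induction principle for the image of [F] and a vanishing criterion for [G]. *)
Lemma sdsum_maps q (N : 'I_q -> sheaf Phi) M
    (f : forall i, shom (N i) M) (g : forall i, shom M (N i)) :
  (forall i s x, g i s (f i s x) = x) ->
  (forall i j s x, i != j -> g j s (f i s x) = 0) ->
  exists (F : shom (sdsum N) M) (G : shom M (sdsum N)),
  [/\ forall s x, F s (G s x) = \sum_i f i s (g i s x),
      forall s (P : M s -> Prop), P 0 -> (forall x y, P x -> P y -> P (x + y)) ->
        (forall i z, P (f i s z)) -> forall y, P (F s y),
      forall s x, (forall i, g i s x = 0) -> G s x = 0 &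
      forall s y, G s (F s y) = y].
Proof.
elim: q N f g => [|q IH] N f g gf gf0.
  rewrite /sdsum big_ord0.
  have F : shom (szero Phi) M.
    apply: (@mk_shom _ _ (fun s _ => 0)) => //.
    - by move=> s a x y; rewrite scaler0 addr0.
    - by move=> s k x _; apply: gdeg0.
    - by move=> s t h x; rewrite res0.
  have G : shom M (szero Phi).
    by apply: (@mk_shom _ _ (fun s _ => 0)) => // s a x y; rewrite scaler0 addr0.
  exists F, G; split=> [s x|s P P0 _ _ y|s x _|s y].
  - by rewrite big_ord0 [G s x]thinmx0 linear0.
  - by rewrite [y]thinmx0 linear0.
  - by rewrite [G s x]thinmx0.
  - by rewrite [LHS]thinmx0 [y]thinmx0.
have -> : sdsum N = sadd (N ord0) (sdsum (fun i => N (lift ord0 i))).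
  exact: big_ord_recl.
have [||F [G [FG FP G0 GF]]] := IH _ (fun i => f (lift ord0 i)) (fun i => g (lift ord0 i)).
- by move=> *; apply: gf.
- by move=> i j s x ij; apply: gf0; rewrite (inj_eq lift_inj).
have F'l s : linear (fun x : sadd (N ord0) (sdsum (fun i => N (lift ord0 i))) s =>
    f ord0 s x.1 + F s x.2).
  by move=> a x y; rewrite !linearP scalerDr addrACA.
have G'l s : linear (fun x : M s => (g ord0 s x, G s x) :
    sadd (N ord0) (sdsum (fun i => N (lift ord0 i))) s).
  by move=> a x y; rewrite !linearP.
have F'd s k x : gdeg k x -> gdeg k (mk_linear (F'l s) x).
  by case=> h1 h2; apply: gdegD; apply: ghom_deg.
have G'd s k x : gdeg k x -> gdeg k (mk_linear (G'l s) x).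
  by move=> h; split; apply: ghom_deg.
exists (mk_shom (M := sadd (N ord0) (sdsum (fun i => N (lift ord0 i)))) F'l F'd
  (fun s t h x => etrans (f_equal2 +%R (shom_res (f ord0) h x.1) (shom_res F h x.2))
     (esym (resD h _ _)))).
exists (mk_shom (N := sadd (N ord0) (sdsum (fun i => N (lift ord0 i)))) G'l G'd
  (fun s t h x => f_equal2 pair (shom_res (g ord0) h x) (shom_res G h x))).
split=> [s x|s P P0 PD Pf y|s x gx|s y] /=.
- by rewrite FG big_ord_recl.
- by apply: (PD); [apply: Pf|apply: (FP s P) => // i z; apply: Pf].
- by rewrite gx G0.
- rewrite !linearD /= gf GF G0 => [|i]; last by apply: gf0; rewrite neq_lift.
  (* The induction principle shows that [g ord0] kills the image of [F]. *)
  rewrite add0r (FP s (fun z => g ord0 s z = 0)) ?linear0 ?addr0 //; first by case: y.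
  + by move=> x x' h h'; rewrite linearD h h' addr0.
  + by move=> i z; apply: gf0; rewrite eq_sym neq_lift.
Qed.

Lemma sdsum_siso q (N : 'I_q -> sheaf Phi) M
    (f : forall i, shom (N i) M) (g : forall i, shom M (N i)) :
  (forall i s x, g i s (f i s x) = x) ->
  (forall i j s x, i != j -> g j s (f i s x) = 0) ->
  (forall s x, \sum_i f i s (g i s x) = x) -> siso M (sdsum N).
Proof.
move=> gf gf0 fg; have [F [G [FG _ _ GF]]] := sdsum_maps gf gf0.
by exists G, F; split=> s x; rewrite ?FG ?fg ?GF.
Qed.

End SheafMaps.

(** * The image of an idempotent endomorphism of a sheaf *)

Section ImageSheaf.
Variables (R : realType) (V : vectType R) (Phi : fan V) (M : sheaf Phi).
Local Notation res N := (res (s0 := N)).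

Variable p : forall s, M s -> M s.
Arguments p : clear implicits.
Hypothesis pl : forall s, linear (p s).
Hypothesis pp : forall s x, p s (p s x) = p s x.
Hypothesis pdeg : forall s k x, gdeg k x -> gdeg k (p s x).
Hypothesis pres : forall s t (h : fle t s) x, res M h (p s x) = p t (res M h x).
Arguments pl : clear implicits.
Arguments pp : clear implicits.
Arguments pdeg : clear implicits.
Arguments pres : clear implicits.
Variable k : int.

Fact im_res_subproof s t (h : fle t s) (x : fixed (pl s)) :
  res M h (fval x) \in fixpt (pl t).
Proof. by apply/eqP; rewrite -pres fvalK. Qed.

Definition im_res s t (h : fle t s) (x : fixed (pl s)) : fixed (pl t) :=
  Fixed (im_res_subproof h x).

Program Definition im_sheaf : sheaf Phi :=
  @Sheaf _ _ _ (fun s => gfix (pl s) (pp s) (pdeg s) k) im_res _ _ _ _ _.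
Next Obligation. by apply: fval_inj; rewrite /= res_semilinear. Qed.
Next Obligation. exact: res_deg. Qed.
Next Obligation. by apply: fval_inj; rewrite /= res_id. Qed.
Next Obligation. by apply: fval_inj; rewrite /= (res_comp _ _ h''). Qed.
Next Obligation.
have [q [e he]] := sheaf_fg M s; exists q, (fun i => fixer (pl s) (pp s) (e i)) => x.
have [c hc] := he (fval x); exists c; apply: fval_inj.
by rewrite fval_sum -fvalK hc -[LHS]/(mk_linear (pl s) _) linear_sum;
   apply: eq_bigr => i _; rewrite linearZ.
Qed.

Definition im_fix s (x : M s) : im_sheaf s := fixer (pl s) (pp s) x.

(** A section of the image is extended inside [M], then projected by [p], which fixes the given
    values. *)
Lemma im_flabby : flabby M -> flabby im_sheaf.
Proof.
move=> flM U oU y.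
have yc s t (sU : s \in U) (tU : t \in U) (h : fle t s) :
    res M h (fval (sect_at y sU)) = fval (sect_at y tU).
  by rewrite -(sect_compat y sU tU h).
have [z zy] := flM U oU (@Sect _ _ _ M U (fun s sU => fval (sect_at y sU)) yc).
have zc s t (sU : s \in [set: Phi]%SET) (tU : t \in [set: Phi]%SET) (h : fle t s) :
    res im_sheaf h (im_fix (sect_at z sU)) = im_fix (sect_at z tU).
  by apply: fval_inj; rewrite /= pres (sect_compat z sU tU h).
exists (Sect zc); apply: sectP => s sU; apply: fval_inj => /=.
have := congr1 (fun y => sect_at y sU) zy => /= ->.
exact: fvalK.
Qed.

End ImageSheaf.

(** * Inclusion of the image and projection onto it *)

Section ImageMaps.
Variables (R : realType) (V : vectType R) (Phi : fan V) (M : sheaf Phi).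
Local Notation res N := (res (s0 := N)).
Variable p : forall s, M s -> M s.
Arguments p : clear implicits.
Hypothesis pl : forall s, linear (p s).
Hypothesis pp : forall s x, p s (p s x) = p s x.
Hypothesis pdeg : forall s k x, gdeg k x -> gdeg k (p s x).
Hypothesis pres : forall s t (h : fle t s) x, res M h (p s x) = p t (res M h x).
Arguments pl : clear implicits.
Arguments pp : clear implicits.
Arguments pdeg : clear implicits.
Arguments pres : clear implicits.

Program Definition im_incl : shom (im_sheaf pl pp pdeg pres 0) M :=
  @mk_shom _ _ _ (im_sheaf pl pp pdeg pres 0) M
    (fun s (x : fixed (pl s)) => fval x) _ _ _.
Next Obligation. by []. Qed.
Next Obligation. by move: H; rewrite /gdeg /= addr0. Qed.

Program Definition im_proj : shom M (im_sheaf pl pp pdeg pres 0) :=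
  @mk_shom _ _ _ M (im_sheaf pl pp pdeg pres 0)
    (fun s (x : M s) => im_fix pl pp pdeg pres 0 x) _ _ _.
Next Obligation. exact: fixer_linear. Qed.
Next Obligation. by rewrite /gdeg /= addr0; apply: pdeg. Qed.
Next Obligation. by apply: fval_inj; rewrite /= pres. Qed.

Variable k : int.

(** The shift by [- k] undoes the regrading by [k], so the inclusion preserves degrees. *)
Program Definition shift_incl : shom (sshift (- k) (im_sheaf pl pp pdeg pres k)) M :=
  @mk_shom _ _ _ (sshift (- k) (im_sheaf pl pp pdeg pres k)) M
    (fun s (x : fixed (pl s)) => fval x) _ _ _.
Next Obligation. by []. Qed.
Next Obligation. by move: H; rewrite /gdeg /= subrK. Qed.

Program Definition shift_proj : shom M (sshift (- k) (im_sheaf pl pp pdeg pres k)) :=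
  @mk_shom _ _ _ M (sshift (- k) (im_sheaf pl pp pdeg pres k))
    (fun s (x : M s) => im_fix pl pp pdeg pres k x) _ _ _.
Next Obligation. exact: fixer_linear. Qed.
Next Obligation. by rewrite /gdeg /= subrK; apply: pdeg. Qed.
Next Obligation. by apply: fval_inj; rewrite /= pres. Qed.

End ImageMaps.

(** * Maps induced modulo the ideal of positive degree *)

Section BarMaps.
Variables (R : realType) (n : nat) (M N : lmodType {mpoly R[n]}).
Variable f : {linear M -> N}.
Local Notation pi M x := (\pi_(bar M) x)%qT.
Local Notation plus L := (plus_sub (N := L)).

Lemma pi_eq (L : lmodType {mpoly R[n]}) (x y : L) :
  pi L x = pi L y <-> x - y \in plus L.
Proof. by rewrite Quotient.idealrBE; split=> /eqP. Qed.

Lemma plus_sub_sum q (a : 'I_q -> {mpoly R[n]}) (x : 'I_q -> M) :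
  (forall i, (a i)@_0%MM = 0) -> \sum_i a i *: x i \in plus M.
Proof. by move=> ha; apply/asboolP; exists q, a, x. Qed.

Lemma bar_map_bij : (forall y, exists x, f x = y) ->
  (forall x, f x \in plus N -> x \in plus M) -> bijective (bar_map f).
Proof.
move=> fs fi.
have inj : injective (bar_map f).
  move=> u v; rewrite -[u]reprK -[v]reprK !bar_map_pi.
  by move=> /pi_eq; rewrite -linearB => /fi; rewrite pi_eq.
have /choice[g fg] (u : bar N) : exists v, bar_map f v = u.
  have [x fx] := fs (repr u); exists (pi M x).
  by rewrite bar_map_pi fx reprK.
by exists g => // u; apply: inj.
Qed.

Lemma bar_map_inj x : bijective (bar_map f) -> f x = 0 -> x \in plus M.
Proof.
move=> /bij_inj inj fx; rewrite -[x]subr0 -pi_eq; apply: inj.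
by rewrite !bar_map_pi fx linear0.
Qed.

End BarMaps.

(** * The summand attached to a label, and its minimality *)

Section Pieces.
Variables (R : realType) (V : vectType R) (Phi : fan V) (M : sheaf Phi).
Variable m : Phi -> nat.
Hypothesis flM : flabby M.
Variable d : forall s, based M m s.
Hypothesis gd : forall s, good s d.
Implicit Types s t u : Phi.

Let bd s := good_basis (gd s).

Fact piece_idem l s (x : M s) : lproj (d s) l (lproj (d s) l x) = lproj (d s) l x.
Proof. by rewrite lproj_orth ?eqxx. Qed.

Definition piece (l : label m) (k : int) : sheaf Phi :=
  im_sheaf (fun s => lproj_linear (bd s) l) (@piece_idem l)
    (fun s k x => lproj_deg (bd s) l (k := k) (x := x))
    (fun s t h x => lproj_res h l x (gd s) (gd t)) k.

Definition root_label (l : label m) : bool := (d (tag l)).2 (tagged l) == l.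

Section Piece.
Variables (l : label m) (k : int).
Local Notation N := (piece l k).

Definition to_piece s (x : M s) : N s := fixer (lproj_linear (bd s) l) (@piece_idem l s) x.

Lemma fval_piece s (x : N s) :
  fval x = \sum_(i | (d s).2 i == l) bco (d s).1 (fval x) i *: (d s).1 i.
Proof. by rewrite -{1}fvalK. Qed.

Lemma piece_free s : gfree (N s).
Proof.
apply/gfree_gbasis; pose J := [set i | (d s).2 i == l]%SET.
exists #|J|, (fun j => to_piece ((d s).1 (enum_val j))).
have ve (j : 'I_#|J|) : fval (to_piece ((d s).1 (enum_val j))) = (d s).1 (enum_val j).
  by have := enum_valP j; rewrite inE /= lproj_e // => ->.
split.
- move=> j; have [/(_ (enum_val j))[h hh] _ _] := bd s; exists (h - k).
  by rewrite /gdeg /= -[X in gdeg _ X]/(fval (to_piece _)) ve subrK.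
- move=> x; exists [ffun j => bco (d s).1 (fval x) (enum_val j)].
  apply: fval_inj; rewrite fval_sum [LHS]fval_piece.
  transitivity (\sum_(i in J) bco (d s).1 (fval x) i *: (d s).1 i).
    by apply: eq_bigl => i; rewrite inE.
  rewrite big_enum_val; apply: eq_bigr => j _; rewrite ffunE.
  by rewrite -{1}ve.
- move=> c c0 j; have := congr1 (fun x : N s => bco (d s).1 (fval x) (enum_val j)) c0.
  rewrite /= bco0 // fval_sum bco_sum // (bigD1 j) //= big1 => [|i ij].
    by rewrite addr0 bcoZ // -[lproj _ _ _]/(fval (to_piece _)) ve bco_e // eqxx mulr1.
  rewrite bcoZ // -[lproj _ _ _]/(fval (to_piece _)) ve bco_e //.
  by rewrite (inj_eq enum_val_inj) eq_sym (negPf ij) mulr0.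
Qed.

Lemma piece_frakM : frakM N.
Proof. by split; [apply: im_flabby|apply: piece_free]. Qed.

Lemma piece_support t : nonzero_at N t -> fle (tag l) t.
Proof.
move=> [x x0]; have [/existsP[i /eqP <-]|/existsPn h] := boolP [exists i, (d t).2 i == l].
  exact: good_tag.
case/eqP: x0; apply: fval_inj; rewrite fval_piece big1 // => i.
by rewrite (negPf (h i)).
Qed.

(** Surjectivity comes from flabbiness. For injectivity, a lift of the expression of the boundary
    section is subtracted from [x]; the remainder [w] vanishes on the boundary, and [good_min] kills
    the constant terms of its coordinates. *)
Lemma piece_min t : t != tag l -> bijective (bar_map (@to_boundary _ _ _ N t)).
Proof.
move=> tl; have [flN _] := piece_frakM.
apply: bar_map_bij => [y|x]; first exact: to_boundary_surj.
move=> /asboolP[q [a [y [ha xy]]]].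
have /choice[z hz] i := to_boundary_surj flN (y i).
pose w : rscal (restr fullv (Span t)) (N t) := x - \sum_i a i *: z i.
suff hw : w \in plus_sub (N := rscal (restr fullv (Span t)) (N t)).
  by rewrite -[x](subrK (\sum_i a i *: z i)) rpredD //; apply: plus_sub_sum.
have bw : to_boundary w = 0.
  rewrite linearB linear_sum xy; apply/eqP; rewrite subr_eq0; apply/eqP.
  by apply: eq_bigr => i _; rewrite linearZ /= hz.
have vw : bvanish (fval (w : N t)).
  move=> u h ut; have uU : u \in boundary t by rewrite in_boundary /flt h.
  have := congr1 (fun y : sect N (boundary t) => fval (sect_at y uU)) bw => /=.
  by rewrite (Prop_irrelevance (boundary_fle uU) h).
pose c i := if (d t).2 i == l then bco (d t).1 (fval (w : N t)) i else 0.
(* The quotient is taken over A, so the coordinates are lifted from the stalk algebra to A. *)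
have -> : w = \sum_i restr (Span t) fullv (c i) *: (to_piece ((d t).1 i) : rscal _ (N t)).
  apply: fval_inj; rewrite fval_sum fval_piece big_mkcond; apply: eq_bigr => i _.
  rewrite -[RHS]/(restr fullv (Span t) _ *: lproj (d t) l ((d t).1 i)).
  by rewrite restrK lproj_e // /c; case: ((d t).2 i == l); rewrite ?scale0r.
apply: plus_sub_sum => i; rewrite restr_const /c; case: eqP => [il|_]; last first.
  by rewrite mcoeff0.
(* A basis element at [t] labelled by itself cannot have label [l], since [tag l] differs from
   [t]. *)
by apply: (good_min (gd t)) => // il'; rewrite -il il' eqxx in tl.
Qed.

Hypothesis rl : root_label l.

Definition piece_gen : N (tag l) := to_piece ((d (tag l)).1 (tagged l)).

Lemma fval_gen : fval piece_gen = (d (tag l)).1 (tagged l).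
Proof. by rewrite /= lproj_e //; move: rl; rewrite /root_label => ->. Qed.

Lemma fval_scale_gen a : fval (a *: piece_gen) = a *: (d (tag l)).1 (tagged l).
Proof. by rewrite -fval_gen. Qed.

Lemma piece_gen_neq0 : piece_gen != 0.
Proof.
apply/eqP => g0; have := bco_e (bd (tag l)) (tagged l) (tagged l).
by rewrite -fval_gen g0 bco0 // eqxx => /eqP; rewrite eq_sym oner_eq0.
Qed.

Lemma piece_minimal : minimal_sheaf (tag l) N.
Proof.
split.
- exact: piece_frakM.
- by exists piece_gen; apply: piece_gen_neq0.
- by move=> t /piece_support; rewrite finset.in_set.
- by move=> t _; apply: piece_min.
Qed.

(** An inherited label comes from a strictly smaller cone, so at [tag l] only the element that
    created [l] carries it. The stalk there has rank one. *)
Lemma label_at_root i : ((d (tag l)).2 i == l) = (i == tagged l).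
Proof.
have [->|il] := eqVneq i (tagged l); first by rewrite -/(root_label l) rl.
apply/negbTE/eqP => e; have := good_lab (gd (tag l)) i.
rewrite e => -[[lE _]|[]]; last by rewrite /flt eqxx andbF.
have /eqP : Tagged (fun s => 'I_(m s)) (tagged l) = lab_of i.
  by rewrite -lE; case: (l).
by rewrite eq_Tagged /= eq_sym (negPf il).
Qed.

Hypothesis hk : gdeg k ((d (tag l)).1 (tagged l)).

(** The isomorphism is the coordinate along the generator, whose degree [k] the regrading moves to
    0. *)
Lemma piece_rank1 : giso (N (tag l)) (greg R (\dim (Span (tag l)))).
Proof.
pose g (a : greg R (\dim (Span (tag l)))) : N (tag l) :=
  (a : {mpoly R[\dim (Span (tag l))]}) *: piece_gen.
pose f (x : N (tag l)) : greg R (\dim (Span (tag l))) :=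
  bco (d (tag l)).1 (fval x) (tagged l).
have gl : linear g by move=> a x y; rewrite /g scalerDl -scalerA.
have fl : linear f by move=> a x y; rewrite /f /= bco_linear.
have gdg j x : gdeg j x -> gdeg j (mk_linear gl x).
  move=> hx; change (gdeg (j + k) (fval (g x))); rewrite /g fval_scale_gen.
  by apply: gdegZ_supp hk _ => q /hx ->; rewrite addrC.
have fdg j x : gdeg j x -> gdeg j (mk_linear fl x).
  move=> hx; change (forall q, q \in msupp (bco (d (tag l)).1 (fval x) (tagged l)) ->
    j = (2 * mdeg q)%N%:Z) => q hq; apply: (addIr k); rewrite [RHS]addrC.
  exact: (bco_homog (bd (tag l)) hx hk hq).
exists (GHom fdg), (GHom gdg); split=> x /=.
  apply: fval_inj; rewrite [RHS]fval_piece (big_pred1 (tagged l)).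
    by rewrite /g fval_scale_gen.
  by move=> i; rewrite label_at_root.
by rewrite /f /g fval_scale_gen bcoZ // bco_e // eqxx mulr1.
Qed.

Lemma piece_is_L : is_L (tag l) N.
Proof. by split; [apply: piece_minimal|apply: piece_rank1]. Qed.

End Piece.
End Pieces.

(** * Indecomposability of the shifts of L^s *)

Section Indecomposable.
Variables (R : realType) (V : vectType R) (Phi : fan V).
Local Notation res N := (res (s0 := N)).

Lemma flabby_shift k (M : sheaf Phi) : flabby M -> flabby (sshift k M).
Proof.
move=> flM U oU y.
have [z zy] := flM U oU (@Sect _ _ _ M U (@sect_at _ _ _ (sshift k M) U y)
  (@sect_compat _ _ _ (sshift k M) U y)).
exists (@Sect _ _ _ (sshift k M) _ (@sect_at _ _ _ M _ z) (@sect_compat _ _ _ M _ z)).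
by apply: sectP => s sU; have := congr1 (fun y => sect_at y sU) zy.
Qed.

Lemma free_shift n k (N : gmod R n) : gfree N -> gfree (gshift k N).
Proof.
move=> [q [e [he hu]]]; exists q, e; split=> // i.
by have [j hj] := he i; exists (j - k); rewrite /gdeg /= subrK.
Qed.

Lemma frakM_shift k (M : sheaf Phi) : frakM M -> frakM (sshift k M).
Proof. by move=> [h1 h2]; split; [apply: flabby_shift|move=> s; apply: free_shift]. Qed.

(* Nakayama's lemma; freeness makes it a matter of constant terms. *)
Lemma free_nakayama n (N : gmod R n) : gfree N ->
  (forall x : N, x \in plus_sub (N := N)) -> forall x : N, x = 0.
Proof.
move=> /gfree_gbasis[q [e be]] h x; rewrite (bcoE be x) big1 // => i _.
have /asboolP[r [a [y [ha ey]]]] := h (e i).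
have := congr1 (fun x => (bco e x i)@_0%MM) ey; rewrite bco_e // eqxx mcoeff1 eqxx.
rewrite bco_sum // raddf_sum big1 => [/eqP|j _]; first by rewrite oner_eq0.
by rewrite bcoZ //= rmorphM /= ha mul0r.
Qed.

(** Induction on faces: if [N] vanishes on the boundary of [t], then [i t x] restricts to zero
    there, and minimality puts it in A^+ L_t. Applying [r] puts [x] in A^+ N_t, and Nakayama's lemma
    concludes. *)
Lemma minimal_retract_eq0 s (L N : sheaf Phi) (k : int)
    (i : shom N (sshift k L)) (r : shom (sshift k L) N) :
  minimal_sheaf s L -> frakM N -> (forall t x, r t (i t x) = x) ->
  (forall x : N s, x = 0) -> is_zero_sheaf N.
Proof.
move=> [_ _ supp bm] [_ frN] ri Ns0; apply: (@face_ind _ _ Phi) => t IH x.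
have [ts|ts] := eqVneq t s; first by subst t.
have [tS|tS] := boolP (t \in Star s); last first.
  rewrite -[x]ri; have [->|ix] := eqVneq (i t x) 0; first exact: linear0.
  by case/negP: tS; apply: supp; exists (i t x).
move: x; apply: (free_nakayama (frN t)) => x.
have bx : @to_boundary _ _ _ L t (i t x) = 0.
  apply: sectP => u ut /=; have := shom_res i (boundary_fle ut) x => /= <-.
  by rewrite [X in i u X]IH ?linear0 -?in_boundary.
have /asboolP[q [a [y [ha xy]]]] := bar_map_inj (bm t tS ts) bx.
rewrite -[x]ri xy.
have -> : r t (\sum_j a j *: y j) =
    \sum_j restr fullv (Span t) (a j) *: r t (y j).
  rewrite -[LHS]/(r t (\sum_j restr fullv (Span t) (a j) *: (y j : sshift k L t))).
  by rewrite linear_sum; apply: eq_bigr => j _; rewrite linearZ.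
by apply: plus_sub_sum => j; rewrite restr_const.
Qed.

Lemma siso_swap (M N1 N2 : sheaf Phi) : siso M (sadd N1 N2) -> siso M (sadd N2 N1).
Proof.
move=> [f [g [fg gf]]].
have fl s : linear (fun x : M s => ((f s x).2, (f s x).1) : sadd N2 N1 s).
  by move=> a x y; rewrite linearP.
have gl s : linear (fun x : sadd N2 N1 s => g s (x.2, x.1)).
  by move=> a x y; rewrite -linearP.
have fd s k x : gdeg k x -> gdeg k (mk_linear (fl s) x).
  by move=> /(ghom_deg (f s))[h1 h2]; split.
have gd s k x : gdeg k x -> gdeg k (mk_linear (gl s) x).
  by move=> [h1 h2]; apply: ghom_deg; split.
have fr s t (h : fle t s) x :
    mk_linear (fl t) (res M h x) = res (sadd N2 N1) h (mk_linear (fl s) x).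
  by rewrite /= (shom_res f h x).
have gr s t (h : fle t s) x :
    mk_linear (gl t) (res (sadd N2 N1) h x) = res M h (mk_linear (gl s) x).
  by rewrite /= -(shom_res g h).
exists (mk_shom (N := sadd N2 N1) fl fd fr), (mk_shom (M := sadd N2 N1) gl gd gr).
split=> s x /=; first by rewrite -surjective_pairing fg.
by rewrite gf; case: x.
Qed.

Lemma summand_eq0 s (L N1 N2 : sheaf Phi) (k : int) :
  minimal_sheaf s L -> frakM N1 -> siso (sshift k L) (sadd N1 N2) ->
  (forall x : N1 s, x = 0) -> is_zero_sheaf N1.
Proof.
move=> mL fN1 [f [g [_ gf]]].
have il t : linear (fun x : N1 t => g t (x, 0)).
  move=> a y z; rewrite -linearP; congr (g t _).
  have e0 : (0 : N2 t) = a *: 0 + 0 by rewrite scaler0 addr0.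
  exact: (congr1 (pair (a *: y + z)) e0).
have rl t : linear (fun x : sshift k L t => (f t x).1).
  by move=> a y z; rewrite linearP.
have idg t j y : gdeg j y -> gdeg j (mk_linear (il t) y).
  by move=> hy; apply: ghom_deg; split=> //; apply: gdeg0.
have rdg t j y : gdeg j y -> gdeg j (mk_linear (rl t) y).
  by move=> /(ghom_deg (f t))[].
have ir t u (h : fle u t) x :
    mk_linear (il u) (res N1 h x) = res (sshift k L) h (mk_linear (il t) x).
  by rewrite /= -(shom_res g h) /= res0.
have rr t u (h : fle u t) x :
    mk_linear (rl u) (res (sshift k L) h x) = res N1 h (mk_linear (rl t) x).
  by rewrite /= (shom_res f h).
apply: (minimal_retract_eq0 (i := mk_shom il idg ir) (r := mk_shom rl rdg rr) mL) => //.
by move=> t x /=; rewrite gf.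
Qed.

(** By [summand_eq0] a summand is zero once its stalk at [s] is. The stalk of [L] there, of rank one
    over a domain, is not a sum of two nonzero modules. *)
Lemma is_L_indecomposable s (L : sheaf Phi) k :
  is_L s L -> indecomposable (sshift k L).
Proof.
move=> [mL [u [v [uK vK]]]]; have [fL [x0 nx0] _ _] := mL; split.
- exact: frakM_shift.
- by move=> /(_ s x0) h; rewrite h eqxx in nx0.
move=> N1 N2 fN1 fN2 e.
have [h1|/existsNP[x nx]] := pselect (forall x : N1 s, x = 0).
  by left; apply: summand_eq0 mL fN1 e h1.
right; apply: summand_eq0 mL fN2 (siso_swap e) _ => y.
apply: contra_notP nx => ny; have [f [g [_ gf]]] := e.
pose w (z : sadd N1 N2 s) : {mpoly R[\dim (Span s)]} := u (g s z).
have wI : injective w by move=> z z' /(can_inj uK)/(can_inj (gf s)).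
have w0 : w 0 = 0 by rewrite /w !linear0.
have wZ a z : w (a *: z) = a * w z.
  transitivity (u (a *: (g s z : L s))); first by congr (u _); rewrite [LHS]linearZ.
  by rewrite [LHS]linearZ.
(* [L s] has rank one, so any two of its elements are linearly dependent. *)
pose P := w (x, 0); pose Q := w (0, y).
have e1 : Q *: ((x, 0) : sadd N1 N2 s) = (Q *: x, 0).
  exact: (congr1 (pair (Q *: x)) (scaler0 _ Q)).
have e2 : P *: ((0, y) : sadd N1 N2 s) = (0, P *: y).
  exact: (congr1 (pair^~ (P *: y)) (scaler0 _ P)).
have : (Q *: x, 0) = (0, P *: y) :> sadd N1 N2 s.
  by apply: wI; rewrite -e1 -e2 !wZ mulrC.
(* Comparing first components gives [Q *: x = 0], which [w] turns into a zero product in a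
   domain. *)
move=> [Qx _]; have /eqP : Q * P = 0 by rewrite -wZ e1 Qx.
by rewrite mulf_eq0 => /orP[] /eqP; rewrite -w0 => /wI[].
Qed.

End Indecomposable.

(** * Assembly of the two direct sums *)

Theorem theorem5p3 (R : realType) (V : vectType R) (Phi : fan V)
    (M : sheaf Phi) (hM : frakM M) :
  (exists (m : nat) (N : 'I_m -> sheaf Phi),
     (forall i, exists s : Phi, minimal_sheaf s (N i)) /\
     siso M (sdsum N)) /\
  (exists (m : nat) (s : 'I_m -> Phi) (t : 'I_m -> int)
          (L : 'I_m -> sheaf Phi),
     (forall i, is_L (s i) (L i) /\ indecomposable (sshift (t i) (L i))) /\
     siso M (sdsum (fun i => sshift (t i) (L i)))).
Proof.
have [flM frM] := hM.
pose m s := projT1 (cid ((gfree_gbasis (M s)).1 (frM s))).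
have bM s : exists e : 'I_(m s) -> M s, gbasis e.
  exact: projT2 (cid ((gfree_gbasis (M s)).1 (frM s))).
have [d gd] := good_ex flM bM.
pose roots := [set l | root_label d l]%SET.
pose l (i : 'I_#|roots|) := enum_val i.
have rl i : root_label d (l i) by have := enum_valP i; rewrite inE.
have /choice[k hk] i : exists k, gdeg k ((d (tag (l i))).1 (tagged (l i))).
  by have [h _ _] := good_basis (gd (tag (l i))); apply: h.
have orth i j s x : i != j -> lproj (d s) (l j) (lproj (d s) (l i) x) = 0.
  move=> ij; rewrite (lproj_orth (good_basis (gd s))) (inj_eq enum_val_inj).
  by rewrite eq_sym (negPf ij).
(* Labels outside [roots] contribute zero, because [good_root] makes every label in use a root
   label. *)
have total s x : \sum_i lproj (d s) (l i) x = x.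
  rewrite -[RHS](lproj_sum (good_basis (gd s))) [RHS](bigID (mem roots)) /=.
  rewrite [X in _ = _ + X]big1 ?addr0 => [|l' nl].
    exact/esym/big_enum_val.
  rewrite /lproj big1 // => i /eqP il; case/negP: nl.
  by rewrite inE /root_label -il good_root.
split.
  exists #|roots|, (fun i => piece gd (l i) 0); split.
    by move=> i; exists (tag (l i)); apply: piece_minimal.
  apply: (sdsum_siso (f := fun i => im_incl _ _ _ _) (g := fun i => im_proj _ _ _ _)).
  - by move=> i s x; apply: fval_inj; rewrite /= fvalK.
  - by move=> i j s x ij; apply: fval_inj; rewrite /= -(fvalK x) orth.
  - by move=> s x /=; apply: total.
(* The same pieces, regraded by the degree [k i] of their generator to become L^s; the shift by
   [- k i] restores the grading of [M]. *)
exists #|roots|, (fun i => tag (l i)), (fun i => - k i), (fun i => piece gd (l i) (k i)).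
split.
  move=> i; have Li : is_L (tag (l i)) (piece gd (l i) (k i)) by apply: piece_is_L.
  by split=> //; apply: is_L_indecomposable Li.
apply: (sdsum_siso (f := fun i => shift_incl _ _ _ _ (k i))
                   (g := fun i => shift_proj _ _ _ _ (k i))).
- by move=> i s x; apply: fval_inj; rewrite /= fvalK.
- by move=> i j s x ij; apply: fval_inj; rewrite /= -(fvalK x) orth.
- by move=> s x /=; apply: total.
Qed.
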